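(* Let $1\le k<n$, let $R\in SYT_k$ be a standard Young tableau whose shape has exactly two rows, and let $R'\in SYT_k$ be another tableau having the same shape as $R$. Let $S,T\in SYT_n^{R}$ and suppose that $S\lessdot_{weak}T$ is a covering relation in $SYT_n^{R}$. Then $\mathcal{V}_{[R,R']}(S)\lessdot_{weak}\mathcal{V}_{[R,R']}(T)$ is a covering relation in $SYT_n^{R'}$.
   Context: $SYT_n$ is the set of standard Young tableaux with $n$ cells (English convention, rows and columns increasing). For a permutation $w\in \mathfrak{S}_n$ (written in one-line notation $w_1\ldots w_n$), $I(w)\in SYT_n$ is its Robinson–Schensted (row) insertion tableau, and for $T\in SYT_n$, $\mathcal{Y}_T=\{w\in \mathfrak{S}_n: I(w)=T\}$ is its Knuth class. The right weak Bruhat order on $\mathfrak{S}_n$ is the transitive (and reflexive) closure of: $u\leq_{weak} w$ if $w=u\cdot s_i$ with $\mathrm{length}(w)=\mathrm{length}(u)+1$, where $s_i=(i,i+1)$; that is, $w$ is obtained from $u=u_1\ldots u_n$ by swapping the letters $u_i<u_{i+1}$ in adjacent positions. The weak order $\leq_{weak}$ on $SYT_n$ is the partial order obtained as the transitive closure of the relation: $S\leq_{weak}T$ if there exist $\sigma\in\mathcal{Y}_S$, $\tau\in\mathcal{Y}_T$ with $\sigma\leq_{weak}\tau$. For $1\le k<n$ and $R\in SYT_k$, $SYT_n^{R}$ is the set of $T\in SYT_n$ whose subtableau $T_{[1,k]}$ consisting of the entries $1,\ldots,k$ equals $R$, ordered by $\leq_{weak}$. For $R,R'\in SYT_k$ of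 the same shape, the inner tableau translation map $\mathcal{V}_{[R,R']}:SYT_n^{R}\to SYT_n^{R'}$ sends $T$ to the tableau obtained by replacing the inner tableau $R$ of $T$ with $R'$ (leaving the other entries in place). $S\lessdot_{weak}T$ means that $S\leq_{weak} T$, $S\neq T$, and there is no tableau $Q\ne S,T$ in the set considered with $S\leq_{weak}Q\leq_{weak}T$. *)

(* Defs.v *)
From mathcomp Require Import all_boot all_fingroup.
From Stdlib Require Import Relation_Operators.

Set Implicit Arguments.
Unset Strict Implicit.
Unset Printing Implicit Defensive.

(* A tableau is the list of its rows, from top to bottom (English convention);
   [shape] (from seq.v) is the list of its row lengths. *)
Definition tableau := seq (seq nat).

(* [r2] may be placed immediately below [r1]. *)
Definition row_above (r1 r2 : seq nat) : bool :=
  (size r2 <= size r1) && all (fun p => p.1 < p.2) (zip r1 r2).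

(* Rows are required to be nonempty, so that each standard Young tableau has a
   unique representation and [size t] is its number of rows. *)
Definition SYT (n : nat) : pred tableau := fun t =>
  [&& [::] \notin t, all (sorted ltn) t, sorted row_above t
    & perm_eq (flatten t) (iota 1 n)].

(* The first entry greater than [x] is bumped into the next row. *)
Fixpoint row_insert (x : nat) (t : tableau) : tableau :=
  if t is r :: t' then
    let i := find (fun y => x < y) r in
    if i < size r then set_nth 0 r i x :: row_insert (nth 0 r i) t'
    else rcons r x :: t'
  else [:: [:: x]].

(* Elements of ['S_n] permute {0, ..., n-1}; the letters are shifted by one. *)
Definition one_line (n : nat) (w : 'S_n) : seq nat :=
  [seq (val (w i)).+1 | i <- enum 'I_n].

Definition insertion_tableau (n : nat) (w : 'S_n) : tableau :=
  foldl (fun t x => row_insert x t) [::] (one_line w).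

Definition knuth_class (n : nat) (T : tableau) : {set 'S_n} :=
  [set w | insertion_tableau w == T].

Definition perm_length (n : nat) (w : 'S_n) : nat :=
  #|[set p : 'I_n * 'I_n | (p.1 < p.2) && (w p.2 < w p.1)]|.

(* The product of {perm _} composes from left to right, so that the classical
   product u . s_i, which swaps the letters of u in positions i and i+1, is
   [tperm i j * u] with j = i+1. *)
Definition perm_weak_step (n : nat) : rel 'S_n := fun u w =>
  [exists i : 'I_n, exists j : 'I_n,
     [&& val j == i.+1, w == (tperm i j * u)%g
       & perm_length w == (perm_length u).+1]].

Definition perm_weak_le (n : nat) : rel 'S_n := connect (@perm_weak_step n).

Definition tab_weak_step (n : nat) (S T : tableau) : Prop :=
  [/\ S \in SYT n, T \in SYT n &
      exists sigma tau : 'S_n,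
        [/\ sigma \in knuth_class n S, tau \in knuth_class n T
          & perm_weak_le sigma tau]].

Definition tab_weak_le (n : nat) : tableau -> tableau -> Prop :=
  clos_trans tableau (tab_weak_step n).

Definition inner_tableau (k : nat) (T : tableau) : tableau :=
  [seq r <- [seq [seq x <- row | x <= k] | row <- T] | r != [::]].

Definition SYT_inner (n k : nat) (R : tableau) : pred tableau := fun T =>
  (T \in SYT n) && (inner_tableau k T == R).

(* Meaningful for [T] with inner tableau [R], and [R'] of the same shape as
   [R]: in each row of [T], the initial segment lying in [R] is replaced by the
   corresponding row of [R']. *)
Definition inner_translation (R R' T : tableau) : tableau :=
  [seq nth [::] R' i ++ drop (size (nth [::] R i)) (nth [::] T i)
  | i <- iota 0 (size T)].

Definition weak_cover (n : nat) (A : pred tableau) (S T : tableau) : Prop :=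
  [/\ S \in A, T \in A, tab_weak_le n S T, S <> T &
      ~ exists Q : tableau,
          [/\ Q \in A, Q <> S, Q <> T, tab_weak_le n S Q & tab_weak_le n Q T]].

(* Main.v *)
Require Import Defs.
From mathcomp Require Import all_boot all_fingroup.
From mathcomp Require Import zify.
From Stdlib Require Import Relation_Operators Setoid Morphisms.

(** Inner translation is an isomorphism of posets from the tableaux with inner
    tableau [R] to those with inner tableau [R'], hence it preserves covers.

    The weak order is handled on words: [weak_le] is generated by Knuth moves
    and by the exchange of an increasing pair of neighbouring letters. Since a
    word is plactically equivalent to the reading word of its insertion tableau,
    [weak_le] between two permutation words is the weak order between their
    tableaux ([tab_weak_le_word], [weak_le_tableau]).

    All members of a chain from [S] to [T] share the inner tableau [R]
    ([weak_le_inner_tableau]). Indeed the length of the longest increasing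
    subsequence in the letters [1..j] decreases weakly along the chain and has the
    same value at both ends, which fixes the first row; and no word of the chain
    has a decreasing subsequence of length three in the letters [1..k], because
    it would persist up to [T]. So it suffices to translate one step at a time.

    Any two tableaux of the same two-rowed shape are joined by flips, which
    exchange [a+1] and [a+2] where [a] lies in the first row and exactly one of
    [a+1], [a+2] lies in the second row ([translates_same_shape]). On words, a
    flip is an elementary dual Knuth transformation. It commutes with Knuth
    moves ([dual_knuth_plactic]) and acts on insertion tableaux by relabelling
    ([rs_tableau_dual_knuth]), which is inner translation.

    It remains to transform an exchange of two neighbouring letters
    ([dual_knuth_weak_step]). Unless these are [a] and [a+2], the transformation
    relabels both words by the same map and the exchange remains one. Otherwise
    the letter [a+1] stands on one side, separated by arbitrary letters, and
    the two words are relabelled differently. If [a+1] stands before, then it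
    stays in the first row until [a] and [a+2] are inserted, because [a+2] ends
    there; both images then reduce to the same first row preceded by two ejected
    letters in opposite orders ([weak_le_312_132]). If [a+1] stands after, then
    the absence of decreasing subsequences of length three makes all the
    separating letters larger than [a+2], and both images reduce to words that
    differ by one exchange next to the first column of these letters
    ([weak_le_231_213]). *)

Set Implicit Arguments.
Unset Strict Implicit.
Unset Printing Implicit Defensive.

(** * Knuth moves and plactic equivalence *)

Inductive knuth_move : seq nat -> seq nat -> Prop :=
| KnuthXZY p q x y z : x < y -> y < z ->
    knuth_move (p ++ [:: x, z, y & q]) (p ++ [:: z, x, y & q])
| KnuthYXZ p q x y z : x < y -> y < z ->
    knuth_move (p ++ [:: y, x, z & q]) (p ++ [:: y, z, x & q]).

Definition plactic := clos_refl_sym_trans _ knuth_move.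

Lemma plactic_refl u : plactic u u. Proof. exact: rst_refl. Qed.
Lemma plactic_sym u v : plactic u v -> plactic v u. Proof. exact: rst_sym. Qed.
Lemma plactic_trans v u w : plactic u v -> plactic v w -> plactic u w.
Proof. exact: rst_trans. Qed.

#[local] Hint Resolve plactic_refl : core.

#[local] Instance plactic_equivalence : Equivalence plactic.
Proof.
split; [exact: plactic_refl|exact: plactic_sym|].
by move=> u v w; apply: plactic_trans.
Qed.

Lemma plactic_map_word (f : seq nat -> seq nat) u v :
  (forall x y, knuth_move x y -> plactic (f x) (f y)) ->
  plactic u v -> plactic (f u) (f v).
Proof.
move=> fP; elim=> {u v} [u v /fP //|u|u v _|u v w _ uv _ vw] //.
- exact: plactic_sym.
- exact: plactic_trans uv vw.
Qed.

Lemma plactic_cat2l p u v : plactic u v -> plactic (p ++ u) (p ++ v).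
Proof.
apply: (@plactic_map_word (cat p)) => x y [a b ? ? ? lt1 lt2|a b ? ? ? lt1 lt2];
  rewrite !catA; apply: rst_step; by constructor.
Qed.

Lemma plactic_cat2r q u v : plactic u v -> plactic (u ++ q) (v ++ q).
Proof.
apply: (@plactic_map_word (cat^~ q)) => x y [a b ? ? ? lt1 lt2|a b ? ? ? lt1 lt2];
  rewrite -!catA; apply: rst_step; by constructor.
Qed.

#[local] Instance plactic_cat_proper :
  Proper (plactic ==> plactic ==> plactic) (@cat nat).
Proof.
move=> u u' uu' v v' vv'.
exact: plactic_trans (plactic_cat2r _ uu') (plactic_cat2l _ vv').
Qed.

#[local] Instance plactic_cons_proper x :
  Proper (plactic ==> plactic) (@cons nat x).
Proof. by move=> u v; apply: (@plactic_cat2l [:: x]). Qed.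

Lemma knuth_xzy x y z q : x < y -> y < z ->
  plactic [:: x, z, y & q] [:: z, x, y & q].
Proof. by move=> xy yz; apply: rst_step; apply: (KnuthXZY [::]). Qed.

Lemma knuth_yxz x y z q : x < y -> y < z ->
  plactic [:: y, x, z & q] [:: y, z, x & q].
Proof. by move=> xy yz; apply: rst_step; apply: (KnuthYXZ [::]). Qed.

Lemma plactic_rev u v : plactic u v -> plactic (rev u) (rev v).
Proof.
apply: plactic_map_word => x y [p q a b c lt1 lt2|p q a b c lt1 lt2];
  rewrite !rev_cat !rev_cons -!cats1 -!catA /=; apply: plactic_cat2l.
- by apply: plactic_sym; apply: knuth_yxz.
- by apply: plactic_sym; apply: knuth_xzy.
Qed.

Lemma knuth_move_perm u v : knuth_move u v -> perm_eq u v.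
Proof. by case=> p q x y z _ _; apply/seq.permP => P; rewrite !count_cat /=; lia. Qed.

Lemma plactic_perm u v : plactic u v -> perm_eq u v.
Proof.
elim=> {u v} [u v /knuth_move_perm //|u|u v _|u v w _ uv _ vw] //.
- by rewrite perm_sym.
- exact: perm_trans uv vw.
Qed.

Lemma row_bump_tail x b q : x < b -> pairwise ltn (b :: q) ->
  plactic (b :: q ++ [:: x]) [:: b, x & q].
Proof.
elim: q b => [|c q IH] b xb //= /andP[/andP[bc bq] /andP[cq qq]].
rewrite IH; [|lia|by rewrite /= cq].
by symmetry; apply: knuth_yxz.
Qed.

Lemma row_bump_head x b p w : x < b -> pairwise ltn p -> all (ltn^~ x) p ->
  plactic (p ++ [:: b, x & w]) (b :: p ++ x :: w).
Proof.
move=> xb; elim: p => [|c p IH] //= /andP[cp pp] /andP[cx px].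
rewrite IH //; case: p cp px {IH pp} => [|d p] /= => [_ _|/andP[cd _] /andP[dx _]];
  apply: knuth_xzy => //; lia.
Qed.

(** Row insertion of [x] into an increasing row ejects the first entry [b]
    beyond [x]; Knuth moves carry [x] leftwards to the place of [b] and then
    [b] leftwards out of the row. *)
Lemma row_bump x b p q : all (ltn^~ x) p -> x < b ->
  pairwise ltn (p ++ b :: q) ->
  plactic (p ++ b :: q ++ [:: x]) (b :: p ++ x :: q).
Proof.
rewrite pairwise_cat => px xb /and3P[_ pp bq].
by rewrite row_bump_tail // row_bump_head.
Qed.


(** * Insertion and Knuth moves *)

Definition insert_word (t : tableau) (w : seq nat) : tableau :=
  foldl (fun t x => row_insert x t) t w.

Definition rs_tableau (w : seq nat) : tableau := insert_word [::] w.

Definition row_word (t : tableau) : seq nat := flatten (rev t).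

Lemma insert_word_cat t u v :
  insert_word t (u ++ v) = insert_word (insert_word t u) v.
Proof. exact: foldl_cat. Qed.

Lemma rs_tableau_rcons u x : rs_tableau (rcons u x) = row_insert x (rs_tableau u).
Proof. by rewrite -cats1 /rs_tableau insert_word_cat. Qed.

Lemma row_word_cons r t : row_word (r :: t) = row_word t ++ r.
Proof. by rewrite /row_word rev_cons flatten_rcons. Qed.

Lemma row_insert_end x r t :
  all (leq^~ x) r -> row_insert x (r :: t) = rcons r x :: t.
Proof.
move=> rx /=; rewrite -has_find.
by case: hasP => // -[y /(allP rx) /=]; lia.
Qed.

Lemma row_insert_bump x p b q t : all (leq^~ x) p -> x < b ->
  row_insert x ((p ++ b :: q) :: t) = (p ++ x :: q) :: row_insert b t.
Proof.
move=> px xb /=.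
have fE : find (fun y => x < y) (p ++ b :: q) = size p.
  rewrite find_cat /= xb addn0; case: hasP => // -[y /(allP px) /=]; lia.
rewrite fE size_cat /= -addSnnS leq_addr nth_cat ltnn subnn /=; congr (_ :: _).
by elim: p {px fE} => //= c p ->.
Qed.

Lemma row_split x r : pairwise leq r ->
  exists p q, [/\ r = p ++ q, all (leq^~ x) p & all (ltn x) q].
Proof.
elim: r => [|c r IH] /=; first by exists [::], [::].
case/andP=> cr /IH[p [q [rE px qx]]]; rewrite {}rE in cr *; case: (leqP c x) => [cx|xc].
  by exists (c :: p), q; rewrite /= cx.
exists [::], (c :: p ++ q); split=> //=; rewrite xc /=.
by apply: sub_all cr => y; apply: leq_trans.
Qed.

Lemma row_insert_bumpE x r p b q t : r = p ++ b :: q -> all (leq^~ x) p ->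
  x < b -> row_insert x (r :: t) = (p ++ x :: q) :: row_insert b t.
Proof. by move=> ->; apply: row_insert_bump. Qed.

Lemma row_insert_nil x : row_insert x [::] = [:: [:: x]]. Proof. by []. Qed.

Arguments row_insert : simpl never.

Ltac order_lia := repeat match goal with
  | H : is_true (all _ _) |- _ => clear H
  | H : is_true (pairwise _ _) |- _ => clear H
  | H : is_true true |- _ => clear H end; lia.

Ltac all_bounds := rewrite ?cats1; (do 3 rewrite ?all_cat ?all_rcons /=);
  repeat (apply/andP; split);
  first [done | match goal with
    | |- is_true (_ <= _) => order_lia
    | H : is_true (all _ ?s) |- is_true (all _ ?s) =>
      solve [refine (sub_all _ H); move=> ? /=; order_lia] end].

Ltac row_side := solve [done | match goal with
    | |- is_true (_ <= _) => order_lia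
    | |- is_true _ => all_bounds
    | _ => by rewrite ?cat_rcons -?cats1 -?catA /= -?catA ?cats0 end].

(** The two words eject, from one row, words that are equal or again related
    by a Knuth move, so the induction on the rows closes. Inequalities are weak
    where this makes the statement true for rows with repeated letters. *)
Lemma insert_knuth t : all (pairwise leq) t -> forall x y z,
  (x <= y < z -> insert_word t [:: x; z; y] = insert_word t [:: z; x; y]) /\
  (x < y <= z -> insert_word t [:: y; x; z] = insert_word t [:: y; z; x]).
Proof.
elim: t => [_|r t IH /= /andP[rr /IH{}IH]] x y z.
  split=> /andP[xy yz]; rewrite /insert_word /= !row_insert_nil.
    rewrite (@row_insert_end z [:: x]); last by all_bounds.
    rewrite (@row_insert_bumpE y _ [:: x] z [::]) //; last by all_bounds.
    rewrite (@row_insert_bumpE x _ [::] z [::]) //; last by lia.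
    by rewrite (@row_insert_end y [:: x]) //; all_bounds.
  rewrite (@row_insert_end z [:: y]); last by all_bounds.
  rewrite (@row_insert_bumpE x _ [::] y [::]) // (@row_insert_bumpE x _ [::] y [:: z]) //.
  by rewrite row_insert_end //; all_bounds.
split=> /andP[xy yz].
- have [p [q [rE px qx]]] := row_split x rr; rewrite {}rE in rr *.
  case: q qx rr => [|b q] /= qx rr.
    rewrite cats0 (@row_insert_end x p); last by all_bounds.
    rewrite (@row_insert_end z p); last by all_bounds.
    rewrite (@row_insert_end z (rcons p x)); last by all_bounds.
    rewrite (@row_insert_bumpE y _ (rcons p x) z [::]); [|row_side|row_side|row_side].
    rewrite (@row_insert_bumpE x _ p z [::]); [|row_side|row_side|row_side].
    by rewrite row_insert_end; [rewrite !cats1|all_bounds].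
  case/andP: qx => xb qx.
  rewrite (@row_insert_bumpE x _ p b q); [|row_side|row_side|row_side].
  case: (ltnP z b) => [zb|bz].
    have pq : all (ltn z) q.
      move: rr; rewrite pairwise_cat /= => /and4P[_ _ bq _].
      by apply: sub_all bq => c /=; lia.
    rewrite (@row_insert_bumpE z (p ++ b :: q) p b q); [|row_side|row_side|row_side].
    rewrite (@row_insert_bumpE x (p ++ z :: q) p z q); [|row_side|row_side|row_side].
    case: q qx rr pq => [|c q] /= qx rr pq.
      rewrite (@row_insert_end z (p ++ [:: x])); last by all_bounds.
      rewrite (@row_insert_end y (p ++ [:: x])); last by all_bounds.
      rewrite (@row_insert_bumpE y _ (rcons p x) z [::]); [|row_side|row_side|row_side].
      by rewrite -!cats1.
    rewrite (@row_insert_bumpE z (p ++ x :: c :: q) (rcons p x) c q); [|row_side|row_side|row_side].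
    rewrite (@row_insert_bumpE y _ (rcons p x) z q); [|row_side|row_side|row_side].
    rewrite (@row_insert_bumpE y (p ++ x :: c :: q) (rcons p x) c q); [|row_side|row_side|row_side].
    congr (_ :: _).
    have bc : b <= c by move: rr; rewrite pairwise_cat /= => /and4P[_ _ /andP[]].
    by symmetry; apply: (IH z b c).2; lia.
  move: rr; rewrite pairwise_cat /= => /and4P[_ _ bq qq].
  have [u [v [qE uz vz]]] := row_split z qq; rewrite {}qE in qx bq qq *.
  have [u1 [u2 [uE u1y u2y]]] : exists u1 u2, [/\ u = u1 ++ u2, all (leq^~ y) u1 & all (ltn y) u2].
    by apply: row_split; move: qq; rewrite pairwise_cat => /and3P[].
  rewrite {}uE in uz qx bq qq *.
  move: qx bq uz; rewrite !all_cat => /andP[/andP[u1x u2x] vx] /andP[/andP[bu1 bu2] bv] /andP[u1z u2z].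
  case: v vz vx bv qq => [|c v] /= vz vx bv qq.
    rewrite !cats0 (@row_insert_end z (p ++ x :: u1 ++ u2)); last by all_bounds.
    rewrite (@row_insert_end z (p ++ b :: u1 ++ u2)); last by all_bounds.
    rewrite (@row_insert_bumpE x _ p b (u1 ++ u2 ++ [:: z])); [|row_side|row_side|row_side].
    by rewrite -cats1 /= -!catA /= -!catA.
  case/andP: vz => zc vz.
  rewrite (@row_insert_bumpE z (p ++ x :: (u1 ++ u2) ++ c :: v) (p ++ x :: u1 ++ u2) c v); [|row_side|row_side|row_side].
  rewrite (@row_insert_bumpE z (p ++ b :: (u1 ++ u2) ++ c :: v) (p ++ b :: u1 ++ u2) c v); [|row_side|row_side|row_side].
  rewrite (@row_insert_bumpE x _ p b (u1 ++ u2 ++ z :: v)); [|row_side|row_side|row_side].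
  case: u2 {qq} u2x u2z u2y bu2 => [|d u2] /= u2x u2z u2y bu2.
    rewrite (@row_insert_bumpE y _ (p ++ x :: u1) z v); [|row_side|row_side|row_side].
    rewrite (@row_insert_bumpE y _ (p ++ x :: u1) z v); [|row_side|row_side|row_side].
    by congr (_ :: _); apply: (IH b z c).1; lia.
  case/andP: u2y => yd u2y; case/andP: u2z => dz u2z; case/andP: bu2 => bd bu2.
  rewrite (@row_insert_bumpE y _ (p ++ x :: u1) d (u2 ++ z :: v)); [|row_side|row_side|row_side].
  rewrite (@row_insert_bumpE y _ (p ++ x :: u1) d (u2 ++ z :: v)); [|row_side|row_side|row_side].
  by congr (_ :: _); apply: (IH b d c).1; rewrite bd (leq_ltn_trans dz zc).
- have [p [q [rE py qy]]] := row_split y rr; rewrite {}rE in rr *.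
  have [P1 [e [P2 [PE P1x xe ey]]]] : exists P1 e P2,
      [/\ p ++ [:: y] = P1 ++ e :: P2, all (leq^~ x) P1, x < e & e <= y].
    have [|p1 [p2 [pE p1x p2x]]] := @row_split x p.
      by move: rr; rewrite pairwise_cat => /and3P[].
    move: py; rewrite pE all_cat => /andP[_].
    case: p2 p2x pE => [|e p2] /= p2x pE p2y.
      by exists p1, y, [::]; rewrite cats0.
    exists p1, e, (p2 ++ [:: y]); rewrite -catA; split=> //; first by case/andP: p2x.
    by case/andP: p2y.
  case: q qy rr => [|c q] /= qy rr.
    rewrite cats0 (@row_insert_end y p); last by all_bounds.
    rewrite (@row_insert_end z (rcons p y)); last by all_bounds.
    rewrite (@row_insert_bumpE x _ P1 e P2) -?cats1 //.
    rewrite (@row_insert_bumpE x _ P1 e (P2 ++ [:: z])) //; last by rewrite PE -catA.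
    rewrite row_insert_end; first by rewrite -cats1 -catA.
    have : all (leq^~ y) (p ++ [:: y]) by all_bounds.
    by rewrite PE all_cat /= => /and3P[? ? ?]; all_bounds.
  case/andP: qy => yc qy.
  have ple : all (leq^~ y) (p ++ [:: y]) by all_bounds.
  rewrite (@row_insert_bumpE y _ p c q) //.
  rewrite (@row_insert_bumpE x _ P1 e (P2 ++ q)) //; last first.
    by rewrite -(cat1s y) catA PE -catA.
  have [|u [v [qE uz vz]]] := @row_split z q.
    by move: rr; rewrite pairwise_cat /= => /and4P[].
  rewrite {}qE in qy rr *.
  have Pz : all (leq^~ z) (P1 ++ x :: P2 ++ u).
    by move: ple; rewrite PE all_cat /= => /and3P[? ? ?]; all_bounds.
  case: v vz qy rr => [|f v] /= vz qy rr.
    rewrite !cats0 (@row_insert_end z (P1 ++ x :: P2 ++ u)) //.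
    rewrite (@row_insert_end z (p ++ y :: u)); last by all_bounds.
    rewrite (@row_insert_bumpE x _ P1 e (P2 ++ rcons u z)) //; last first.
      by rewrite -!cats1 -(cat1s y) !catA PE -!catA.
    by rewrite -!cats1 -!catA /= -!catA.
  case/andP: vz => zf vz.
  rewrite (@row_insert_bumpE z (P1 ++ _) (P1 ++ x :: P2 ++ u) f v) //; last first.
    by rewrite -!catA /= -!catA.
  rewrite (@row_insert_bumpE z (p ++ _) (p ++ y :: u) f v) //; last first.
  - by all_bounds.
  - by rewrite -!catA.
  rewrite (@row_insert_bumpE x _ P1 e (P2 ++ u ++ z :: v)) //; last first.
    by rewrite -(cat1s y) -!catA (catA p) PE -!catA.
  rewrite -!catA /= -!catA; congr (_ :: _).
  have cf : c <= f.
    by move: rr; rewrite pairwise_cat /= all_cat /= => /and4P[_ _ /and3P[]].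
  by apply: (IH e c f).2; lia.
Qed.


(** * Insertion tableaux and their reading words *)

Lemma pairwise_leq_insert x t :
  all (pairwise leq) t -> all (pairwise leq) (row_insert x t).
Proof.
elim: t x => [|r t IH] x //= /andP[rr tt].
have [p [q [rE px qx]]] := row_split x rr; rewrite {}rE in rr *.
case: q qx rr => [|b q] /= qx rr.
  rewrite cats0 row_insert_end //= tt andbT -cats1 pairwise_cat allrel1r /=.
  by rewrite cats0 in rr; rewrite rr px.
case/andP: qx => xb qx.
rewrite row_insert_bump //= IH // andbT.
move: rr; rewrite !pairwise_cat /= !allrel_consr => /and4P[/andP[_ ->] -> _ ->].
rewrite px /= andbT; apply: sub_all qx => y; exact: ltnW.
Qed.

Lemma pairwise_leq_insert_word w t :
  all (pairwise leq) t -> all (pairwise leq) (insert_word t w).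
Proof. by elim: w t => //= x w IH t /(pairwise_leq_insert x)/IH. Qed.

Lemma rs_tableau_plactic u v : plactic u v -> rs_tableau u = rs_tableau v.
Proof.
elim=> {u v} [u v|//|u v _ ->|u v w _ -> _ ->] //.
have knuthP p : all (pairwise leq) (rs_tableau p) by apply: pairwise_leq_insert_word.
case=> p q x y z xy yz; rewrite /rs_tableau !insert_word_cat.
  rewrite (insert_word_cat _ [:: x; z; y] q) (insert_word_cat _ [:: z; x; y] q).
  by rewrite ((insert_knuth (knuthP p) x y z).1) // yz ltnW.
rewrite (insert_word_cat _ [:: y; x; z] q) (insert_word_cat _ [:: y; z; x] q).
by rewrite ((insert_knuth (knuthP p) x y z).2) // xy ltnW.
Qed.

Lemma pairwise_ltn_leq r : pairwise ltn r -> pairwise leq r.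
Proof. by apply: sub_pairwise => x y; apply: ltnW. Qed.

Lemma row_insert_cases x r t : pairwise ltn r -> x \notin r ->
  (all (ltn^~ x) r /\ row_insert x (r :: t) = rcons r x :: t) \/
  (exists p b q, [/\ r = p ++ b :: q, all (ltn^~ x) p, x < b & all (ltn b) q] /\
     row_insert x (r :: t) = (p ++ x :: q) :: row_insert b t).
Proof.
move=> rr xr; have [p [q [rE px qx]]] := row_split x (pairwise_ltn_leq rr).
have {}px : all (ltn^~ x) p.
  apply/allP => y yp; rewrite /= ltn_neqAle (allP px) // andbT.
  by apply: contra xr => /eqP <-; rewrite rE mem_cat yp.
have px' : all (leq^~ x) p by apply: sub_all px => y; apply: ltnW.
case: q qx rE => [|b q] /= qx rE.
  by left; rewrite rE cats0 row_insert_end.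
right; exists p, b, q; rewrite rE row_insert_bump //; last by case/andP: qx.
case/andP: qx => xb _; split=> //; split=> //.
by move: rr; rewrite rE pairwise_cat /= => /and4P[].
Qed.

Lemma perm_row_insert x t : all (pairwise ltn) t -> uniq (x :: flatten t) ->
  perm_eq (flatten (row_insert x t)) (x :: flatten t).
Proof.
elim: t x => [|r t IH] x //= /andP[rr tt].
rewrite mem_cat negb_or => /andP[/andP[xr xt] urt].
have [[_ ->] /=|[p [b [q [[rE _ _ _] ->]]]] /=] := row_insert_cases t rr xr.
  by apply/seq.permP => P; rewrite -cats1 !count_cat /= !count_cat /=; lia.
have ubt : uniq (b :: flatten t).
  move: urt; rewrite rE cat_uniq => /and3P[_ h ut] /=; rewrite ut andbT.
  by apply: contra h => bt; apply/hasP; exists b => //; rewrite mem_cat inE eqxx orbT.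
apply/seq.permP => P; have /seq.permP/(_ P) := IH b tt ubt.
by rewrite rE /= !count_cat /= => ->; lia.
Qed.

(** By [row_bump], the letter moves through each row and leaves it as the bumped
    one; so a word is equivalent to the reading word of its insertion tableau. *)
Lemma plactic_row_insert x t : all (pairwise ltn) t -> uniq (x :: flatten t) ->
  plactic (row_word (row_insert x t)) (rcons (row_word t) x).
Proof.
elim: t x => [|r t IH] x //= /andP[rr tt].
rewrite mem_cat negb_or => /andP[/andP[xr xt] urt].
have [[_ ->] /=|[p [b [q [[rE px xb bq] ->]]]] /=] := row_insert_cases t rr xr.
  by rewrite !row_word_cons rcons_cat.
have ubt : uniq (b :: flatten t).
  move: urt; rewrite rE cat_uniq => /and3P[_ h ut] /=; rewrite ut andbT.
  by apply: contra h => bt; apply/hasP; exists b => //; rewrite mem_cat inE eqxx orbT.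
rewrite !row_word_cons IH // rE -!cats1 -!catA; apply: plactic_cat2l.
by symmetry; apply: row_bump => //; rewrite -rE.
Qed.

Lemma row_aboveP r1 r2 :
  reflect (size r2 <= size r1 /\
           forall i, i < size r2 -> nth 0 r1 i < nth 0 r2 i)
          (row_above r1 r2).
Proof.
rewrite /row_above; apply: (iffP andP) => -[le_sz h]; split=> //; move: le_sz h.
  elim: r1 r2 => [|x r1 IH] [|y r2] //= le_sz /andP[xy h] [|i] //= lt_i.
  exact: IH.
elim: r1 r2 => [|x r1 IH] [|y r2] //= le_sz h; rewrite (h 0) //=.
by apply: IH => // i; apply: (h i.+1).
Qed.

Definition is_tableau (t : tableau) : bool :=
  [&& [::] \notin t, all (pairwise ltn) t & sorted row_above t].

Lemma SYT_tableau n t : (t \in SYT n) = is_tableau t && perm_eq (flatten t) (iota 1 n).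
Proof.
rewrite /is_tableau unfold_in -!andbA; congr (_ && (_ && _)).
by apply: eq_all => r; apply: sorted_pairwise; apply: ltn_trans.
Qed.

(** The entry [b] bumped from the row above lands weakly to the left of its old
    column, below an entry that is at most [x] or stood to the left of [b]. *)
Lemma row_above_bump x p b q p2 q2 : all (ltn^~ x) p -> x < b ->
  all (ltn^~ b) p2 -> row_above (p ++ b :: q) (p2 ++ q2) ->
  row_above (p ++ x :: q) (p2 ++ b :: behead q2).
Proof.
move=> px xb p2b /row_aboveP[]; rewrite !size_cat /= => le_sz cols.
have le_p : size p2 <= size p.
  rewrite leqNgt; apply/negP => lt_p.
  have := cols (size p); rewrite !nth_cat ltnn subnn lt_p /= => h.
  by have /allP/(_ _ (mem_nth 0 lt_p)) /= := p2b; lia.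
have nth_le i : nth 0 (p ++ x :: q) i <= nth 0 (p ++ b :: q) i.
  by rewrite !nth_cat; case: ltnP => // _; case: (i - _) => //=; apply: ltnW.
have p_lt i : i <= size p -> nth 0 (p ++ x :: q) i < b.
  rewrite leq_eqVlt nth_cat => /predU1P[->|lt_i]; first by rewrite ltnn subnn.
  by rewrite lt_i; have /allP/(_ _ (mem_nth 0 lt_i)) /= := px; lia.
apply/row_aboveP; rewrite !size_cat /= size_behead; split; first by lia.
move=> i lt_i; have [->|neq_i] := eqVneq i (size p2).
  by rewrite [nth 0 (p2 ++ _) _]nth_cat ltnn subnn p_lt.
have -> : nth 0 (p2 ++ b :: behead q2) i = nth 0 (p2 ++ q2) i.
  rewrite !nth_cat; case: ltnP => // ge_i.
  have -> : i - size p2 = (i - size p2).-1.+1 by lia.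
  by rewrite /= nth_behead.
by apply: leq_ltn_trans (nth_le i) (cols i _); lia.
Qed.

Lemma is_tableau_cons r t : is_tableau (r :: t) =
  [&& r != [::], pairwise ltn r, (if t is r2 :: _ then row_above r r2 else true)
    & is_tableau t].
Proof.
rewrite /is_tableau in_cons negb_or eq_sym.
case: t => [|r2 t] /=; rewrite ?andbT //.
by rewrite -!andbA; do !bool_congr.
Qed.

Lemma is_tableau_rows t : is_tableau t -> all (pairwise ltn) t.
Proof. by case/and3P. Qed.

Lemma uniq_row_catE (x : nat) (r : seq nat) (t : tableau) : uniq (x :: flatten (r :: t)) ->
  [/\ x \notin r, uniq (x :: flatten t) & {in r, forall b, uniq (b :: flatten t)}].
Proof.
rewrite /= mem_cat negb_or cat_uniq => /andP[/andP[-> ->] /and3P[_ h ->]].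
by split=> // b br; rewrite andbT; apply: contra h => bt; apply/hasP; exists b.
Qed.

Lemma is_tableau_row_insert x t : is_tableau t -> uniq (x :: flatten t) ->
  is_tableau (row_insert x t).
Proof.
elim: t x => [|r t IH] x // tabt /uniq_row_catE[xr xt ut].
move: tabt; rewrite is_tableau_cons => /and4P[r0 rr ab tabt].
have [[rx ->]|[p [b [q [[rE px xb bq] ->]]]]] := row_insert_cases t rr xr.
  rewrite is_tableau_cons tabt -cats1 pairwise_cat allrel1r rx rr /= andbT.
  apply/andP; split; first by case: (r).
  case: t ab {IH xt ut tabt} => // r2 t /row_aboveP[le_sz cols].
  apply/row_aboveP; rewrite size_cat; split; first by lia.
  by move=> i lt_i; rewrite nth_cat (leq_trans lt_i le_sz) cols.
have ubt : uniq (b :: flatten t) by apply: ut; rewrite rE mem_cat inE eqxx orbT.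
rewrite is_tableau_cons (IH b tabt ubt) andbT; apply/and3P; split.
- by case: (p).
- move: rr; rewrite rE !pairwise_cat /= !allrel_consr px => /and4P[/andP[_ ->] -> _ ->].
  by rewrite /= andbT; apply: sub_all bq => y; apply: ltn_trans.
rewrite rE in ab; case: t tabt ab ubt {IH ut xt} => [|r2 t] tabt ab ubt.
  by rewrite row_insert_nil; apply: (@row_above_bump x p b q [::] [::]) => //; apply/row_aboveP.
move: tabt; rewrite is_tableau_cons => /and4P[_ rr2 _ _].
have [br2 _ _] := uniq_row_catE ubt.
have [[r2b ->]|[p2 [c [q2 [[r2E p2b _ _] ->]]]]] := row_insert_cases t rr2 br2.
  by rewrite -cats1; have := @row_above_bump x p b q r2 [::]; rewrite cats0; apply.
by rewrite r2E in ab; apply: (@row_above_bump x p b q p2 (c :: q2)).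
Qed.

Lemma rs_tableau_spec w : uniq w ->
  [/\ is_tableau (rs_tableau w), perm_eq (flatten (rs_tableau w)) w
    & plactic w (row_word (rs_tableau w))].
Proof.
elim/last_ind: w => [|w x IH] //; rewrite rcons_uniq => /andP[xw uw].
have [tabw pw plw] := IH uw.
have ux : uniq (x :: flatten (rs_tableau w)).
  by rewrite /= (perm_mem pw) xw (perm_uniq pw).
rewrite rs_tableau_rcons; split.
- exact: is_tableau_row_insert.
- apply: perm_trans (perm_row_insert (is_tableau_rows tabw) ux) _.
  by rewrite perm_sym perm_rcons perm_cons perm_sym.
- rewrite plactic_row_insert ?is_tableau_rows // -!cats1.
  exact: plactic_cat2r.
Qed.

(** The stage reached when the first [i] letters of the row [r] have been
    inserted into [t], for a tableau [r :: t]: the first [i] columns have moved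
    down by one row. *)
Fixpoint push_columns (i : nat) (r : seq nat) (t : tableau) : tableau :=
  match t with
  | [::] => if take i r is [::] then [::] else [:: take i r]
  | r2 :: t' => (take i r ++ drop i r2) :: push_columns i r2 t'
  end.

Lemma push_columns0 r t : push_columns 0 r t = t.
Proof. by elim: t r => [|r2 t IH] r /=; rewrite take0 // drop0 IH. Qed.

Lemma push_columns_all i r t : is_tableau (r :: t) -> size r <= i ->
  push_columns i r t = r :: t.
Proof.
elim: t r => [|r2 t IH] r; rewrite is_tableau_cons => /and4P[r0 _ ab tabt] le_r /=.
  by rewrite take_oversize //; case: (r) r0.
have [le_sz _] := row_aboveP _ _ ab.
by rewrite take_oversize // drop_oversize ?(leq_trans le_sz) // cats0 IH // (leq_trans le_sz).
Qed.

Lemma push_columns_step i r t : is_tableau (r :: t) -> i < size r ->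
  row_insert (nth 0 r i) (push_columns i r t) = push_columns i.+1 r t.
Proof.
elim: t r => [|r2 t IH] r tab lt_i;
  move: (tab); rewrite is_tableau_cons => /and4P[r0 rr ab tabt] /=;
  have lei : all (leq^~ (nth 0 r i)) (take i r).
1,3: move: rr; rewrite -{1}(cat_take_drop i r) (drop_nth 0 lt_i) pairwise_cat allrel_consr;
  by case/and3P=> /andP[h _] _ _; apply: sub_all h => y; apply: ltnW.
  rewrite (take_nth 0) //.
  case E : (take i r) lei => [|y s] lei; first by rewrite row_insert_nil.
  by rewrite row_insert_end // -E; case: (rcons _ _).
have [le_sz cols] := row_aboveP _ _ ab.
rewrite (take_nth 0) //; case: (ltnP i (size r2)) => [lt_i2|ge_i2].
  rewrite (drop_nth 0) // row_insert_bump ?cols // IH //.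
  by rewrite cat_rcons.
rewrite !drop_oversize ?(leq_trans ge_i2) // !cats0 row_insert_end //.
by rewrite !push_columns_all // ltnW.
Qed.

Lemma insert_first_row r t : is_tableau (r :: t) -> insert_word t r = r :: t.
Proof.
move=> tab; rewrite -(push_columns_all tab (leqnn _)).
suff H i : i <= size r -> insert_word t (take i r) = push_columns i r t.
  by rewrite -[r in insert_word t r]take_size H.
elim: i => [|i IH] lt_i; first by rewrite take0 push_columns0.
rewrite (take_nth 0) // -cats1 insert_word_cat IH ?(ltnW lt_i) //=.
exact: push_columns_step.
Qed.

(** Each row of the reading word, when inserted, pushes the rows already present
    down by one. *)
Lemma rs_tableau_row_word t : is_tableau t -> rs_tableau (row_word t) = t.
Proof.
elim: t => [|r t IH] // tab; rewrite row_word_cons /rs_tableau insert_word_cat.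
rewrite -/(rs_tableau _) IH ?insert_first_row //.
by move: tab; rewrite is_tableau_cons => /and4P[].
Qed.


(** * The weak order on words and increasing subsequences *)

Inductive weak_step : seq nat -> seq nat -> Prop :=
| WeakStep p q a b : a < b -> weak_step (p ++ [:: a, b & q]) (p ++ [:: b, a & q]).

(** On words that are permutations, this preorder induces the weak order on
    insertion tableaux. *)
Inductive weak_le : seq nat -> seq nat -> Prop :=
| WeakPlactic u v : plactic u v -> weak_le u v
| WeakCover u v : weak_step u v -> weak_le u v
| WeakTrans u v w : weak_le u v -> weak_le v w -> weak_le u w.

Lemma weak_step_perm u v : weak_step u v -> perm_eq u v.
Proof. by case=> p q a b _; apply/seq.permP => P; rewrite !count_cat /=; lia. Qed.

Lemma weak_le_perm u v : weak_le u v -> perm_eq u v.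
Proof.
elim=> {u v} [u v /plactic_perm|u v /weak_step_perm|u v w _ uv _ vw] //.
exact: perm_trans uv vw.
Qed.

Definition has_increasing (k m : nat) (w : seq nat) : Prop :=
  exists s, [/\ subseq s w, pairwise ltn s, all (leq^~ k) s & m <= size s].

Lemma subseq_catP (T : eqType) (s u v : seq T) : subseq s (u ++ v) ->
  exists s1 s2, [/\ s = s1 ++ s2, subseq s1 u & subseq s2 v].
Proof.
case/subseqP=> m sz ->; exists (mask (take (size u) m) u), (mask (drop (size u) m) v).
split; try exact: mask_subseq.
rewrite -mask_cat ?cat_take_drop // size_takel // sz size_cat; exact: leq_addr.
Qed.

(** An increasing subsequence that crosses a factor [b] can be rerouted through
    a factor [c] if each increasing subsequence of [b] is matched by one of [c]
    that lies within the same bounds. *)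
Definition reroutes (b c : seq nat) : Prop :=
  forall s, subseq s b -> pairwise ltn s ->
  exists s', [/\ subseq s' c, pairwise ltn s', size s' = size s
    & forall e, (all (ltn e) s -> all (ltn e) s') /\
                (all (ltn^~ e) s -> all (ltn^~ e) s')].

Lemma has_increasing_reroute p b c q k m : reroutes b c ->
  has_increasing k m (p ++ b ++ q) -> has_increasing k m (p ++ c ++ q).
Proof.
move=> bc [s [/subseq_catP[s1 [s' [-> s1p /subseq_catP[s2 [s3 [-> s2b s3q]]]]]]]].
rewrite !pairwise_cat !allrel_catr !all_cat.
case/and3P=> /andP[a12 a13] p1 /and3P[a23 p2 p3] /and3P[k1 k2 k3] ms.
have [s4 [s4c p4 sz4 bd]] := bc _ s2b p2.
exists (s1 ++ s4 ++ s3); split.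
- by rewrite !cat_subseq.
- rewrite !pairwise_cat !allrel_catr a13 p1 p4 p3 !andbT /=; apply/andP; split.
    by apply/allP => e e1; apply: (bd e).1; apply: (allP a12).
  rewrite allrelC; apply/allP => e e3 /=; apply: (bd e).2.
  by move: a23; rewrite allrelC => /allP/(_ e e3).
- by rewrite !all_cat k1 k3 andbT /=; apply: (bd k.+1).2.
- by move: ms; rewrite !size_cat sz4.
Qed.

Ltac subseq_short := apply/subseqP; solve [
    by exists [:: true; true; true]
  | by exists [:: true; true; false]
  | by exists [:: true; false; true]
  | by exists [:: true; false; false]
  | by exists [:: false; true; true]
  | by exists [:: false; true; false]
  | by exists [:: false; false; true]
  | by exists [:: false; false; false]
  | by exists [:: true; true]
  | by exists [:: true; false]
  | by exists [:: false; true]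
  | by exists [:: false; false]].

(* Treats the subsequences that are not increasing by [nlt], and those that occur
   in the other factor too. *)
Ltac reroute_same nlt := let incr := fresh in intro incr;
  first [by move: incr; rewrite /= ?nlt ?andbF |
    try match goal with |- exists s', [/\ _, _, _ = size ?s & _] =>
      let s' := eval simpl in s in
      exists s'; split; [subseq_short | exact: incr | done | done] end].

Lemma reroutes_knuth_xzy x y z : x < y -> y < z ->
  reroutes [:: x; z; y] [:: z; x; y] /\ reroutes [:: z; x; y] [:: x; z; y].
Proof.
move=> xy yz; have nlt : ((z < x) = false) * ((z < y) = false).
  by rewrite !ltnNge (ltnW yz) (ltnW (ltn_trans xy yz)).
split=> _ /subseqP[m sz ->];
  move: m sz => [|[] [|[] [|[] [|]]]] // _; reroute_same nlt.
exists [:: x; y]; split; [by subseq_short|by rewrite /= xy|done|].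
move=> e /=; rewrite !andbT; split=> /andP[h1 h2]; first by rewrite h1 (ltn_trans h1 xy).
by rewrite h1 (ltn_trans yz h2).
Qed.

Lemma reroutes_knuth_yxz x y z : x < y -> y < z ->
  reroutes [:: y; x; z] [:: y; z; x] /\ reroutes [:: y; z; x] [:: y; x; z].
Proof.
move=> xy yz; have nlt : ((y < x) = false) * ((z < x) = false).
  by rewrite !ltnNge (ltnW xy) (ltnW (ltn_trans xy yz)).
split=> _ /subseqP[m sz ->];
  move: m sz => [|[] [|[] [|[] [|]]]] // _; reroute_same nlt.
exists [:: y; z]; split; [by subseq_short|by rewrite /= yz|done|].
move=> e /=; rewrite !andbT; split=> /andP[h1 h2]; first by rewrite h2 (ltn_trans h1 xy).
by rewrite h2 (ltn_trans yz h2).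
Qed.

Lemma reroutes_swap a b : a < b -> reroutes [:: b; a] [:: a; b].
Proof.
move=> ab _ /subseqP[m sz ->]; have nlt : (b < a) = false by rewrite ltnNge ltnW.
by move: m sz => [|[] [|[] [|]]] // _; reroute_same nlt.
Qed.

Lemma has_increasing_plactic k m u v :
  plactic u v -> has_increasing k m u <-> has_increasing k m v.
Proof.
elim=> {u v} [u v|//|u v _ IH|u v w _ IH1 _ IH2]; [|by rewrite IH|by rewrite IH1].
case=> p q x y z xy yz.
  by split; apply: (@has_increasing_reroute _ [:: _; _; _] [:: _; _; _]);
    case: (reroutes_knuth_xzy xy yz).
by split; apply: (@has_increasing_reroute _ [:: _; _; _] [:: _; _; _]);
  case: (reroutes_knuth_yxz xy yz).
Qed.

Lemma weak_step_rev u v : weak_step u v -> weak_step (rev v) (rev u).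
Proof.
by case=> p q a b ab; rewrite !rev_cat !rev_cons -!cats1 -!catA /=; constructor.
Qed.

Lemma has_increasing_step k m u v :
  weak_step u v -> has_increasing k m v -> has_increasing k m u.
Proof.
case=> p q a b ab; apply: (@has_increasing_reroute p [:: b; a] [:: a; b] q).
exact: reroutes_swap.
Qed.

Lemma has_increasing_weak_le k m u v :
  weak_le u v -> has_increasing k m v -> has_increasing k m u.
Proof.
elim=> {u v} [u v uv|u v|u v w _ IH1 _ IH2] h; last by auto.
- exact/(has_increasing_plactic _ _ uv).
- exact: has_increasing_step h.
Qed.

Lemma has_increasing_rev_weak_le k m u v :
  weak_le u v -> has_increasing k m (rev u) -> has_increasing k m (rev v).
Proof.
elim=> {u v} [u v uv|u v uv|u v w _ IH1 _ IH2] h; last by auto.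
- exact/(has_increasing_plactic _ _ (plactic_rev uv)).
- exact: has_increasing_step (weak_step_rev uv) h.
Qed.

Lemma row_above_count k r1 r2 :
  row_above r1 r2 -> count (leq^~ k) r2 <= count (ltn^~ k) r1.
Proof.
elim: r1 r2 => [|x r1 IH] [|y r2] // /andP[le_sz /andP[xy ab]] /=.
have /IH : row_above r1 r2 by apply/andP.
move: xy => /=.
by case: (leqP y k); case: (ltnP x k); lia.
Qed.

Lemma count_ltn_leq k r : count (ltn^~ k) r <= count (leq^~ k) r.
Proof. by apply: sub_count => x; apply: ltnW. Qed.

Lemma subseq_sorted_last s : pairwise ltn s -> s != [::] -> all (leq^~ (last 0 s)) s.
Proof.
case/lastP: s => // s x; rewrite -cats1 pairwise_cat allrel1r => /and3P[h _ _] _.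
rewrite last_cat all_cat /= leqnn !andbT; apply: sub_all h => y; exact: ltnW.
Qed.

Lemma count_interval_leq v k r : v <= k ->
  count (ltn^~ v) r + count (predI (ltn v) (leq^~ k)) r <= count (leq^~ k) r.
Proof.
move=> vk; elim: r => //= c r IH; rewrite addnACA leq_add //.
by case: ltnP => /= [cv|vc]; [rewrite ltnNge (ltnW cv) (leq_trans (ltnW cv) vk)|case: (v < c)].
Qed.

(** An increasing subsequence of the reading word uses each column at most
    once. *)
Lemma increasing_row_word_le k t s : is_tableau t -> subseq s (row_word t) ->
  pairwise ltn s -> all (leq^~ k) s -> size s <= count (leq^~ k) (head [::] t).
Proof.
elim: t s k => [|r t IH] s k; first by rewrite subseq0 => _ /eqP ->.
rewrite is_tableau_cons row_word_cons => /and4P[_ rr ab tabt].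
case/subseq_catP=> s1 [s2 [-> s1t s2r]].
rewrite pairwise_cat all_cat size_cat => /and3P[s12 p1 p2] /andP[k1 k2] /=.
have [s10|s1n] := eqVneq s1 [::].
  rewrite s10 add0n; apply: leq_trans (leq_count_subseq (leq^~ k) s2r).
  by rewrite (all_count (leq^~ k) s2) in k2; rewrite (eqP k2).
set v := last 0 s1; have vs1 : v \in s1 by rewrite /v; case: (s1) s1n => // c s0 _; apply: mem_last.
have le1 : size s1 <= count (leq^~ v) (head [::] t).
  exact: IH tabt s1t p1 (subseq_sorted_last p1 s1n).
case: t ab tabt s1t {IH} le1 => [|r2 t] ab tabt s1t le1; first by move: le1 s1n; case: (s1).
have le2 := row_above_count v ab.
have le3 : size s2 <= count (predI (ltn v) (leq^~ k)) r.
  apply: leq_trans (leq_count_subseq _ s2r); rewrite leq_eqVlt eq_sym -all_count.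
  by apply/orP; left; rewrite all_predI k2 andbT; apply: (allP s12).
have := count_interval_leq r (allP k1 v vs1).
by apply: leq_trans; apply: leq_add le3; apply: leq_trans le2.
Qed.

Lemma has_increasing_row_word k m t : is_tableau t ->
  has_increasing k m (row_word t) <-> m <= count (leq^~ k) (head [::] t).
Proof.
move=> tab; split=> [[s [sw ps ks ms]]|le_m].
  exact: leq_trans ms (increasing_row_word_le tab sw ps ks).
case: t tab le_m => [|r t] /=; first by exists [::].
rewrite is_tableau_cons row_word_cons => /and4P[_ rr _ _] le_m.
exists (filter (leq^~ k) r); split; rewrite ?size_filter ?filter_all //.
  by apply: subseq_trans (filter_subseq _ _) (suffix_subseq _ _).
exact: subseq_pairwise (filter_subseq _ _) rr.
Qed.


(** * Inner tableaux with two rows *)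

Lemma no_small_below k r t : is_tableau (r :: t) -> ~~ has (leq^~ k) r ->
  ~~ has (leq^~ k) (flatten t).
Proof.
elim: t r => [|r2 t IH] r //; rewrite is_tableau_cons => /and4P[_ _ ab tab] nr.
have nr2 : ~~ has (leq^~ k) r2.
  rewrite has_count -leqNgt; apply: leq_trans (row_above_count k ab) _.
  by apply: leq_trans (count_ltn_leq k r) _; rewrite leqNgt -has_count.
by rewrite /= has_cat negb_or nr2; apply: IH nr2.
Qed.

Lemma perm_row_word t : perm_eq (row_word t) (flatten t).
Proof.
elim: t => [|r t IH] //; rewrite row_word_cons perm_catC /= perm_cat2l.
exact: IH.
Qed.

Lemma small_word_two_rows k t : is_tableau t -> ~~ has (leq^~ k) (nth [::] t 2) ->
  filter (leq^~ k) (row_word t) =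
  filter (leq^~ k) (nth [::] t 1) ++ filter (leq^~ k) (nth [::] t 0).
Proof.
case: t => [|r0 [|r1 t]] //=.
- by rewrite /row_word /= cats0.
rewrite !is_tableau_cons => /and4P[_ _ _ /and4P[_ _ _ tab]] h.
rewrite !row_word_cons !filter_cat.
suff -> : filter (leq^~ k) (row_word t) = [::] by [].
apply/eqP; rewrite -(negbK (_ == _)) -has_filter.
case: t tab h => [|r2 t] // tab h; rewrite row_word_cons has_cat negb_or h andbT.
have := no_small_below tab h; apply: contra => /hasP[x xt xk]; apply/hasP; exists x => //.
by rewrite -(perm_mem (perm_row_word t)).
Qed.

Lemma monotone_both_ways s : pairwise ltn s -> pairwise ltn (rev s) -> size s <= 1.
Proof.
case: s => [|x [|y s]] //= /andP[/andP[xy _] _] /subseq_pairwise h.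
have /h /= : subseq [:: y; x] (rev [:: x, y & s]).
  by rewrite -[[:: y; x]]/(rev [:: x; y]) subseq_rev /= !eqxx sub0seq.
by rewrite andbT => /andP[]; lia.
Qed.

(** The first entries of the first three rows decrease in the reading word.
    Conversely, if the letters up to [k] occupy two rows only, then a decreasing
    subsequence of these letters has at most one letter in each of them. *)
Lemma has_decreasing_row_word k t : is_tableau t ->
  has_increasing k 3 (rev (row_word t)) <-> has (leq^~ k) (nth [::] t 2).
Proof.
move=> tab; split=> [[s [sw ps ks ms]]|].
  apply: contraLR ms => no3; rewrite -ltnNge.
  have : subseq (rev s) (filter (leq^~ k) (row_word t)).
    by rewrite subseq_filter all_rev ks -subseq_rev revK.
  rewrite small_word_two_rows // => /subseq_catP[s1 [s2 [sE h1 h2]]].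
  have incr i : pairwise ltn (filter (leq^~ k) (nth [::] t i)).
    apply: (subseq_pairwise (filter_subseq _ _)); have [lt_i|ge_i] := ltnP i (size t).
      exact: (allP (is_tableau_rows tab) _ (mem_nth _ lt_i)).
    by rewrite nth_default.
  have rsE : s = rev s2 ++ rev s1 by rewrite -rev_cat -sE revK.
  move: ps; rewrite rsE pairwise_cat => /and3P[_ p2 p1].
  have sz1 := monotone_both_ways (subseq_pairwise h1 (incr 1)) p1.
  have sz2 := monotone_both_ways (subseq_pairwise h2 (incr 0)) p2.
  by rewrite size_cat !size_rev ltnS; apply: (leq_add sz2 sz1).
case: t tab => [|r0 [|r1 [|r2 t]]] // tab.
move: (tab); rewrite !is_tableau_cons => /and4P[r00 rr0 ab0] /and4P[r10 rr1 ab1] /and4P[_ rr2 _ _].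
move: rr2 r00 r10 ab0 ab1; case: r2 {tab} => [|z r2] //; case: r1 {rr1} => [|y r1] //; case: r0 {rr0} => [|x r0] //.
move=> rr2 _ _ /row_aboveP[_ /(_ 0 isT) /= xy] /row_aboveP[_ /(_ 0 isT) /= yz] h.
have zk : z <= k.
  case/orP: h => // /hasP[c cr2 ck]; apply: leq_trans ck; apply: ltnW.
  by move: rr2 => /= /andP[/allP/(_ c cr2)].
exists [:: x; y; z]; split=> //=; [|by rewrite xy yz (ltn_trans xy yz)|by rewrite zk; lia].
rewrite -subseq_rev revK !row_word_cons -!catA.
apply: (@subseq_trans _ ([:: z] ++ [:: y] ++ [:: x])) => //.
apply: (subseq_trans _ (suffix_subseq _ _)).
by do !apply: cat_subseq; rewrite sub1seq inE eqxx.
Qed.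

Definition inner_rows (k : nat) (t : tableau) (r0 r1 : seq nat) : Prop :=
  [/\ filter (leq^~ k) (nth [::] t 0) = r0, filter (leq^~ k) (nth [::] t 1) = r1
    & ~~ has (leq^~ k) (nth [::] t 2)].

Lemma inner_tableau_nil k t : ~~ has (leq^~ k) (flatten t) -> inner_tableau k t = [::].
Proof.
rewrite /inner_tableau; elim: t => [|r t IH] //=; rewrite has_cat negb_or has_filter negbK.
by case/andP=> /eqP -> /IH.
Qed.

Lemma inner_tableau_two_rows k t r0 r1 : is_tableau t -> r0 != [::] -> r1 != [::] ->
  inner_tableau k t = [:: r0; r1] <-> inner_rows k t r0 r1.
Proof.
move=> tab r00 r10; case: t tab => [|t0 t] tab.
  by split=> // -[r0E]; rewrite -r0E in r00.
have [h0|h0] := boolP (has (leq^~ k) t0); last first.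
  rewrite inner_tableau_nil; last by rewrite /= has_cat negb_or h0 (no_small_below tab).
  split=> // -[/= r0E]; move: h0; rewrite has_filter r0E r00 //.
have inner_cons r s : has (leq^~ k) r ->
    inner_tableau k (r :: s) = filter (leq^~ k) r :: inner_tableau k s.
  by rewrite /inner_tableau /= has_filter => ->.
rewrite inner_cons //; case: t tab => [|t1 t] tab.
  by split=> // -[_ r1E]; rewrite -r1E in r10.
move: (tab); rewrite is_tableau_cons => /and4P[_ _ _ tab1].
have [h1|h1] := boolP (has (leq^~ k) t1); last first.
  rewrite inner_tableau_nil; last by rewrite /= has_cat negb_or h1 (no_small_below tab1).
  split=> // -[/= _ r1E]; move: h1; rewrite has_filter r1E r10 //.
rewrite inner_cons //; move: tab1; rewrite is_tableau_cons => /and4P[_ _ _ tab2].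
case: t {tab} tab2 => [|t2 t] tab2; first by split=> [[<- <-]|[/= <- <-]].
have [h2|h2] := boolP (has (leq^~ k) t2).
  by rewrite inner_cons //; split=> // -[_ _] /=; rewrite h2.
rewrite inner_tableau_nil; last by rewrite /= has_cat negb_or h2 (no_small_below tab2).
by split=> [[<- <-]|[/= <- <-]].
Qed.

Lemma eq_count_leq_sorted k r s : pairwise ltn r -> pairwise ltn s ->
  all (leq^~ k) r -> all (leq^~ k) s ->
  (forall j, j <= k -> count (leq^~ j) r = count (leq^~ j) s) -> r = s.
Proof.
move=> pr ps kr ks eq_c.
have sorted_uniq' q : pairwise ltn q -> uniq q.
  by rewrite -(sorted_pairwise ltn_trans); apply: sorted_uniq ltn_trans ltnn _.
have count0E q : count (leq^~ 0) q = count_mem 0 q.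
  by apply: eq_count => x /=; rewrite leqn0.
have countSE x q : count (leq^~ x.+1) q = count (leq^~ x) q + count_mem x.+1 q.
  by elim: q => //= y q ->; case: (ltngtP y x.+1) => /=; case: (leqP y x) => /=; lia.
have memE x : x <= k -> (x \in r) = (x \in s).
  move=> xk; have := count_uniq_mem x (sorted_uniq' r pr).
  have := count_uniq_mem x (sorted_uniq' s ps).
  suff -> : count_mem x r = count_mem x s by move=> ->; do 2 case: (x \in _).
  case: x xk => [|x] xk; first by rewrite -!count0E eq_c.
  by have := eq_c _ xk; rewrite !countSE eq_c; [lia|exact: ltnW].
apply: (irr_sorted_eq ltn_trans ltnn); rewrite ?(sorted_pairwise ltn_trans) // => x.
case: (leqP x k) => [/memE //|kx].
by apply/idP/idP => [/(allP kr)|/(allP ks)] /=; lia.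
Qed.

Lemma tableau_nth_row t i : is_tableau t -> pairwise ltn (nth [::] t i).
Proof.
move=> tab; have [lt_i|ge_i] := ltnP i (size t); last by rewrite nth_default.
exact: (allP (is_tableau_rows tab) _ (mem_nth _ lt_i)).
Qed.

Lemma rows_determined k t r0 r1 : is_tableau t -> uniq (flatten t) -> inner_rows k t r0 r1 ->
  forall x, (x \in r1) = [&& x <= k, x \in flatten t & x \notin r0].
Proof.
move=> tab ut [<- <- no3] x; rewrite !mem_filter; case: (leqP x k) => //= xk.
case: t tab ut no3 => [|t0 [|t1 t]] tab ut no3 //=.
  by rewrite cats0 andbN.
rewrite !mem_cat; have -> : (x \in flatten t) = false.
  apply/negP => xt; move: tab; rewrite !is_tableau_cons => /and4P[_ _ _ /and4P[_ _ _ tab]].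
  case: t tab no3 xt {ut} => [|t2 t] // tab no3 xt.
  have /hasP[] : has (leq^~ k) (flatten (t2 :: t)) by apply/hasP; exists x.
  move=> y yt yk; have := no_small_below tab no3; move: yt => /=.
  rewrite mem_cat => /orP[yt2|yt]; first by case/hasP: no3; exists y.
  by case/hasP; exists y.
rewrite orbF; move: ut; rewrite /= cat_uniq => /and3P[_ h _].
case x1: (x \in t1); rewrite ?orbT /= ?orbF ?andbN //.
by apply/esym; apply: contra h => x0; apply/hasP; exists x; rewrite // mem_cat x1.
Qed.

(** Up the weak order, the longest increasing subsequences in the letters
    [1..j] can only shrink. Their lengths count the letters up to [j] in the
    first row and agree at the ends of the chain, so the first row of the inner
    tableau is constant. A letter of the inner tableau in the third row would
    give a decreasing subsequence of length three, which would persist up to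
    [w]. *)
Lemma weak_le_inner_tableau (k : nat) (R : tableau) (u v w : seq nat) :
  uniq v -> weak_le u v -> weak_le v w -> size R = 2 -> [::] \notin R ->
  inner_tableau k (rs_tableau u) = R -> inner_tableau k (rs_tableau w) = R ->
  inner_tableau k (rs_tableau v) = R.
Proof.
case: R => [|r0 [|r1 [|? ?]]] // uv le_uv le_vw _.
rewrite !inE !negb_or ![[::] == _]eq_sym => /andP[r00 r10].
have uu : uniq u by rewrite (perm_uniq (weak_le_perm le_uv)).
have uw : uniq w by rewrite -(perm_uniq (weak_le_perm le_vw)).
have [tabu pu plu] := rs_tableau_spec uu.
have [tabv pv plv] := rs_tableau_spec uv.
have [tabw pw plw] := rs_tableau_spec uw.
move=> /(inner_tableau_two_rows _ tabu r00 r10) inu /(inner_tableau_two_rows _ tabw r00 r10) inw.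
apply/(inner_tableau_two_rows _ tabv r00 r10).
have no3 : ~~ has (leq^~ k) (nth [::] (rs_tableau v) 2).
  case: inw => _ _; apply: contra.
  move/(has_decreasing_row_word _ tabv)/(has_increasing_plactic _ _ (plactic_rev plv)).
  move/(has_increasing_rev_weak_le le_vw)/(has_increasing_plactic _ _ (plactic_rev plw)).
  by move/(has_decreasing_row_word _ tabw).
have row0 : filter (leq^~ k) (nth [::] (rs_tableau v) 0) = r0.
  have [<- _ _] := inu; have [e _ _] := inw.
  have sortedf t : is_tableau t -> pairwise ltn (filter (leq^~ k) (nth [::] t 0)).
    by move=> tab; apply: subseq_pairwise (filter_subseq _ _) (tableau_nth_row 0 tab).
  apply: (@eq_count_leq_sorted k); rewrite ?filter_all ?sortedf // => j jk.
  have count_small s : count (leq^~ j) (filter (leq^~ k) s) = count (leq^~ j) s.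
    rewrite count_filter; apply: eq_count => x /=.
    by case: (leqP x j) => //= xj; rewrite (leq_trans xj jk).
  have e' : count (leq^~ j) (nth [::] (rs_tableau u) 0) = count (leq^~ j) (nth [::] (rs_tableau w) 0).
    by rewrite -count_small -[RHS]count_small e; case: inu => ->.
  rewrite !count_small; apply/eqP; rewrite eqn_leq; apply/andP; split.
    rewrite !nth0; apply/(has_increasing_row_word _ _ tabu)/(has_increasing_plactic _ _ plu).
    apply: has_increasing_weak_le le_uv _; apply/(has_increasing_plactic _ _ plv).
    exact/(has_increasing_row_word _ _ tabv).
  rewrite e' !nth0; apply/(has_increasing_row_word _ _ tabv)/(has_increasing_plactic _ _ plv).
  apply: has_increasing_weak_le le_vw _; apply/(has_increasing_plactic _ _ plw).
  exact/(has_increasing_row_word _ _ tabw).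
split=> //.
have inv : inner_rows k (rs_tableau v) r0 (filter (leq^~ k) (nth [::] (rs_tableau v) 1)) by [].
have sorted1 : pairwise ltn r1.
  by case: inu => _ <- _; apply: subseq_pairwise (filter_subseq _ _) (tableau_nth_row 1 tabu).
apply: (irr_sorted_eq ltn_trans ltnn); rewrite ?(sorted_pairwise ltn_trans) //.
  exact: subseq_pairwise (filter_subseq _ _) (tableau_nth_row 1 tabv).
move=> x; rewrite (rows_determined tabv _ inv) ?(perm_uniq pv) //.
rewrite (rows_determined tabu _ inu) ?(perm_uniq pu) // (perm_mem pu) (perm_mem pv).
by rewrite (perm_mem (weak_le_perm le_uv)).
Qed.


(** * Dual Knuth transformations of words *)

Definition swap_succ (c x : nat) : nat :=
  if x == c then c.+1 else if x == c.+1 then c else x.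

Lemma swap_succ_ltn c x y : x < y -> ~~ ((x == c) && (y == c.+1)) ->
  swap_succ c x < swap_succ c y.
Proof. by rewrite /swap_succ; do ?[case: ifP => ?]; lia. Qed.

Lemma swap_succ_id c x : x != c -> x != c.+1 -> swap_succ c x = x.
Proof. by rewrite /swap_succ => /negbTE -> /negbTE ->. Qed.

Lemma swap_succK c : involutive (swap_succ c).
Proof.
move=> x; rewrite /swap_succ; have [->|nc] := eqVneq x c.
  by rewrite eqxx; case: eqP => //; lia.
by have [->|ns] := eqVneq x c.+1; rewrite ?eqxx // (negbTE nc) (negbTE ns).
Qed.

Lemma map_swap_succ_id c s : c \notin s -> c.+1 \notin s -> map (swap_succ c) s = s.
Proof.
move=> h1 h2; apply: map_id_in => x xs; rewrite swap_succ_id //.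
- by apply: contraNneq h1 => xE; rewrite -xE.
- by apply: contraNneq h2 => xE; rewrite -xE.
Qed.

Definition in_triple (a : nat) : pred nat := fun x => a <= x <= a.+2.

Definition triple_map (a : nat) (pattern : seq nat) : nat -> nat :=
  if pattern \in [:: [:: a.+1; a; a.+2]; [:: a.+2; a; a.+1]] then swap_succ a.+1
  else if pattern \in [:: [:: a; a.+2; a.+1]; [:: a.+1; a.+2; a]] then swap_succ a
  else id.

(** The elementary dual Knuth transformation on the values [a], [a+1], [a+2]
    exchanges the patterns 213 and 312, and the patterns 132 and 231, of these
    three letters, leaving them in place if they occur in another pattern. *)
Definition dual_knuth (a : nat) (w : seq nat) : seq nat :=
  map (triple_map a (filter (in_triple a) w)) w.

Lemma adjacent_pattern1 a s1 s2 i j :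
  s1 ++ [:: i, j & s2] \in [:: [:: a.+1; a; a.+2]; [:: a.+2; a; a.+1]] ->
  (i == a.+1) && (j == a.+2) || (i == a.+2) && (j == a.+1) = false.
Proof.
by case: s1 => [|? [|? [|? [|? ?]]]] /=; rewrite !inE -!eqseqE /=; case: s2 => [|? [|? ?]] /=; lia.
Qed.

Lemma adjacent_pattern2 a s1 s2 i j :
  s1 ++ [:: i, j & s2] \in [:: [:: a; a.+2; a.+1]; [:: a.+1; a.+2; a]] ->
  (i == a) && (j == a.+1) || (i == a.+1) && (j == a) = false.
Proof.
by case: s1 => [|? [|? [|? [|? ?]]]] /=; rewrite !inE -!eqseqE /=; case: s2 => [|? [|? ?]] /=; lia.
Qed.


(** The relabelling reverses the order of two consecutive values only if the
    third letter of the triple stands between them. *)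
Lemma triple_map_ltn a p q x y w : x < y ->
  w = p ++ [:: x, y & q] \/ w = p ++ [:: y, x & q] ->
  triple_map a (filter (in_triple a) w) x < triple_map a (filter (in_triple a) w) y.
Proof.
move=> xy wE; rewrite /triple_map; case: ifP => [in1|_]; last case: ifP => [in2|_] //.
  apply: swap_succ_ltn => //; apply/negP => /andP[/eqP xE /eqP yE].
  have tx : in_triple a x by rewrite /in_triple; lia.
  have ty : in_triple a y by rewrite /in_triple; lia.
  case: wE in1 => ->; rewrite filter_cat /= tx ty => /adjacent_pattern1;
    by rewrite xE yE !eqxx /= ?orbT.
apply: swap_succ_ltn => //; apply/negP => /andP[/eqP xE /eqP yE].
have tx : in_triple a x by rewrite /in_triple; lia.
have ty : in_triple a y by rewrite /in_triple; lia.
case: wE in2 => ->; rewrite filter_cat /= tx ty => /adjacent_pattern2;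
  by rewrite xE yE !eqxx /= ?orbT.
Qed.

Definition outside (a : nat) (s : seq nat) : bool := all (predC (in_triple a)) s.

Lemma outsideP a s :
  reflect [/\ a \notin s, a.+1 \notin s & a.+2 \notin s] (outside a s).
Proof.
apply: (iffP allP) => [out|[h0 h1 h2] x xs /=].
  by split; apply/negP => /out /=; rewrite /in_triple; lia.
apply/negP; rewrite /in_triple => tx.
have : x \in [:: a; a.+1; a.+2] by rewrite !inE; lia.
by rewrite !inE => /or3P[] /eqP xE; move: h0 h1 h2; rewrite -xE xs.
Qed.

Lemma perm_outside a s w : uniq w -> perm_eq w (s ++ [:: a; a.+1; a.+2]) -> outside a s.
Proof.
move=> uw pw; move: uw; rewrite (perm_uniq pw) uniq_catC cat_uniq => /and3P[_ h _].
by apply/outsideP; split; apply: contra h => h; apply/hasP;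
  [exists a|exists a.+1|exists a.+2]; rewrite // !inE eqxx ?orbT.
Qed.

Ltac perm_count := apply/seq.permP => P; repeat (rewrite ?cats0 ?count_cat /=); lia.

Lemma filter_outside a s : outside a s -> filter (in_triple a) s = [::].
Proof. by rewrite /outside all_predC has_filter negbK => /eqP. Qed.

Lemma map_triple_outside a pat s : outside a s -> map (triple_map a pat) s = s.
Proof.
case/outsideP=> h0 h1 h2; rewrite /triple_map.
by case: ifP => _; last case: ifP => _; rewrite ?map_id ?map_swap_succ_id.
Qed.

Lemma dual_knuth_outside a s1 s2 s3 s4 i j l :
  all (outside a) [:: s1; s2; s3; s4] -> all (in_triple a) [:: i; j; l] ->
  let g := triple_map a [:: i; j; l] in
  dual_knuth a (s1 ++ i :: s2 ++ j :: s3 ++ l :: s4) =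
  s1 ++ g i :: s2 ++ g j :: s3 ++ g l :: s4.
Proof.
move=> /= /and5P[h1 h2 h3 h4 _] /and4P[ti tj tl _]; set g := triple_map _ _; rewrite /dual_knuth.
have -> : filter (in_triple a) (s1 ++ i :: s2 ++ j :: s3 ++ l :: s4) = [:: i; j; l].
  rewrite filter_cat filter_outside //= ti filter_cat filter_outside //= tj.
  by rewrite filter_cat filter_outside //= tl filter_outside.
by rewrite !map_cat /= !map_cat /= !map_cat /= !map_triple_outside.
Qed.

Lemma triple_map_213 a pat : pat \in [:: [:: a.+1; a; a.+2]; [:: a.+2; a; a.+1]] ->
  [/\ triple_map a pat a = a, triple_map a pat a.+1 = a.+2
    & triple_map a pat a.+2 = a.+1].
Proof.
by rewrite /triple_map /swap_succ => ->; split; do ?[case: ifP => ?]; lia.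
Qed.

Lemma triple_map_132 a pat : pat \in [:: [:: a; a.+2; a.+1]; [:: a.+1; a.+2; a]] ->
  [/\ triple_map a pat a = a.+1, triple_map a pat a.+1 = a
    & triple_map a pat a.+2 = a.+2].
Proof.
rewrite /triple_map /swap_succ => h; rewrite h ifF.
  by split; do ?[case: ifP => ?]; lia.
by move: h; rewrite !inE => /orP[] /eqP ->; rewrite -!eqseqE /=; lia.
Qed.

Lemma dual_knuth_213 a s1 s2 s3 s4 : all (outside a) [:: s1; s2; s3; s4] ->
  dual_knuth a (s1 ++ a.+1 :: s2 ++ a :: s3 ++ a.+2 :: s4) =
  s1 ++ a.+2 :: s2 ++ a :: s3 ++ a.+1 :: s4.
Proof.
move=> out; rewrite dual_knuth_outside //; last by rewrite /= /in_triple; lia.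
by have [|-> -> ->] := @triple_map_213 a [:: a.+1; a; a.+2]; rewrite ?inE ?eqxx ?orbT.
Qed.

Lemma dual_knuth_312 a s1 s2 s3 s4 : all (outside a) [:: s1; s2; s3; s4] ->
  dual_knuth a (s1 ++ a.+2 :: s2 ++ a :: s3 ++ a.+1 :: s4) =
  s1 ++ a.+1 :: s2 ++ a :: s3 ++ a.+2 :: s4.
Proof.
move=> out; rewrite dual_knuth_outside //; last by rewrite /= /in_triple; lia.
by have [|-> -> ->] := @triple_map_213 a [:: a.+2; a; a.+1]; rewrite ?inE ?eqxx ?orbT.
Qed.

Lemma dual_knuth_132 a s1 s2 s3 s4 : all (outside a) [:: s1; s2; s3; s4] ->
  dual_knuth a (s1 ++ a :: s2 ++ a.+2 :: s3 ++ a.+1 :: s4) =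
  s1 ++ a.+1 :: s2 ++ a.+2 :: s3 ++ a :: s4.
Proof.
move=> out; rewrite dual_knuth_outside //; last by rewrite /= /in_triple; lia.
by have [|-> -> ->] := @triple_map_132 a [:: a; a.+2; a.+1]; rewrite ?inE ?eqxx ?orbT.
Qed.

Lemma dual_knuth_231 a s1 s2 s3 s4 : all (outside a) [:: s1; s2; s3; s4] ->
  dual_knuth a (s1 ++ a.+1 :: s2 ++ a.+2 :: s3 ++ a :: s4) =
  s1 ++ a :: s2 ++ a.+2 :: s3 ++ a.+1 :: s4.
Proof.
move=> out; rewrite dual_knuth_outside //; last by rewrite /= /in_triple; lia.
by have [|-> -> ->] := @triple_map_132 a [:: a.+1; a.+2; a]; rewrite ?inE ?eqxx ?orbT.
Qed.

(** Knuth moves exchange neighbouring positions and dual Knuth moves exchange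
    neighbouring values; the two kinds of moves commute. *)
Lemma dual_knuth_move a u v : uniq u -> knuth_move u v ->
  plactic (dual_knuth a u) (dual_knuth a v).
Proof.
move=> uu mv; case: mv uu => p q x y z xy yz uu.
- have [tri|ntri] := boolP (in_triple a x && in_triple a z).
    have [xE yE zE] : [/\ x = a, y = a.+1 & z = a.+2] by move: tri; rewrite /in_triple; split; lia.
    rewrite {}xE {}yE {}zE in uu *.
    have : outside a (p ++ q) by apply: (perm_outside uu); perm_count.
    rewrite /outside all_cat => /andP[outp outq].
    have out : all (outside a) [:: p; [::]; [::]; q] by rewrite /= /outside outp outq.
    rewrite (dual_knuth_132 out) (dual_knuth_312 out) /=.
    by symmetry; apply: plactic_cat2l; apply: knuth_yxz.
  have patE : filter (in_triple a) (p ++ [:: z, x, y & q]) =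
              filter (in_triple a) (p ++ [:: x, z, y & q]).
    by move: ntri; rewrite !filter_cat /=; do 2 case: (in_triple a _).
  have ltyz := @triple_map_ltn a (rcons p x) q y z _ yz (or_intror erefl).
  have ltxy := @triple_map_ltn a (rcons p z) q x y _ xy (or_introl erefl).
  move: ltyz ltxy; rewrite !cat_rcons patE /dual_knuth patE !map_cat /= => ltyz ltxy.
  by apply: plactic_cat2l; apply: knuth_xzy.
- have [tri|ntri] := boolP (in_triple a x && in_triple a z).
    have [xE yE zE] : [/\ x = a, y = a.+1 & z = a.+2] by move: tri; rewrite /in_triple; split; lia.
    rewrite {}xE {}yE {}zE in uu *.
    have : outside a (p ++ q) by apply: (perm_outside uu); perm_count.
    rewrite /outside all_cat => /andP[outp outq].
    have out : all (outside a) [:: p; [::]; [::]; q] by rewrite /= /outside outp outq.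
    rewrite (dual_knuth_213 out) (dual_knuth_231 out) /=.
    by symmetry; apply: plactic_cat2l; apply: knuth_xzy.
  have patE : filter (in_triple a) (p ++ [:: y, z, x & q]) =
              filter (in_triple a) (p ++ [:: y, x, z & q]).
    by move: ntri; rewrite !filter_cat /=; do 3 case: (in_triple a _).
  have ltxy := @triple_map_ltn a p (z :: q) x y _ xy (or_intror erefl).
  have ltyz := @triple_map_ltn a p (x :: q) y z _ yz (or_introl erefl).
  move: ltyz ltxy; rewrite patE /dual_knuth patE !map_cat /= => ltyz ltxy.
  by apply: plactic_cat2l; apply: knuth_yxz.
Qed.

Lemma dual_knuth_plactic a u v : uniq u -> plactic u v ->
  plactic (dual_knuth a u) (dual_knuth a v).
Proof.
move=> + uv; elim: uv => {u v} [u v mv uu|//|u v pl IH uv|u v w pl1 IH1 _ IH2 uu].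
- exact: dual_knuth_move.
- by symmetry; apply: IH; rewrite (perm_uniq (plactic_perm pl)).
- by apply: plactic_trans (IH1 uu) (IH2 _); rewrite -(perm_uniq (plactic_perm pl1)).
Qed.


(** * Flips of tableaux and inner translation *)

(** Of the placements of [a], [a+1], [a+2] in the rows of a tableau, the two
    below have reading words with patterns 213 and 312, which the dual Knuth
    transformation exchanges. *)
Definition middle_below (a : nat) (t : tableau) : bool :=
  [&& a \in nth [::] t 0, a.+1 \in nth [::] t 1 & a.+2 \in nth [::] t 0].

Definition last_below (a : nat) (t : tableau) : bool :=
  [&& a \in nth [::] t 0, a.+1 \in nth [::] t 0 & a.+2 \in nth [::] t 1].

Definition flippable (a : nat) (t : tableau) : bool := middle_below a t || last_below a t.

Definition flip_tableau (a : nat) (t : tableau) : tableau := map (map (swap_succ a.+1)) t.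

Lemma nth_flip a t i : nth [::] (flip_tableau a t) i = map (swap_succ a.+1) (nth [::] t i).
Proof.
have [lt_i|ge_i] := ltnP i (size t); first by rewrite (nth_map [::]).
by rewrite !nth_default ?size_map.
Qed.

Lemma mem_map_swap_succ c x s : (x \in map (swap_succ c) s) = (swap_succ c x \in s).
Proof. by rewrite -{1}(swap_succK c x) mem_map //; apply: inv_inj; apply: swap_succK. Qed.

Lemma swap_succ_left c : swap_succ c c = c.+1.
Proof. by rewrite /swap_succ eqxx. Qed.

Lemma swap_succ_right c : swap_succ c c.+1 = c.
Proof. by rewrite -{1}swap_succ_left swap_succK. Qed.

Lemma swap_succ_pred a : swap_succ a.+1 a = a.
Proof. by rewrite swap_succ_id //; lia. Qed.

Lemma middle_below_flip a t : middle_below a (flip_tableau a t) = last_below a t.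
Proof.
rewrite /middle_below /last_below !nth_flip !mem_map_swap_succ.
by rewrite swap_succ_pred swap_succ_left swap_succ_right; congr (_ && _); rewrite andbC.
Qed.

Lemma last_below_flip a t : last_below a (flip_tableau a t) = middle_below a t.
Proof.
rewrite /middle_below /last_below !nth_flip !mem_map_swap_succ.
by rewrite swap_succ_pred swap_succ_left swap_succ_right; congr (_ && _); rewrite andbC.
Qed.

Lemma flippable_flip a t : flippable a (flip_tableau a t) = flippable a t.
Proof. by rewrite /flippable middle_below_flip last_below_flip orbC. Qed.

Lemma flip_tableauK a t : flip_tableau a (flip_tableau a t) = t.
Proof. by rewrite /flip_tableau -map_comp map_id_in // => r _ /=; rewrite mapK //; apply: swap_succK. Qed.

Lemma filter_triple_row a r s : pairwise ltn r -> pairwise ltn s -> all (in_triple a) s ->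
  (forall x, x \in [:: a; a.+1; a.+2] -> (x \in r) = (x \in s)) ->
  filter (in_triple a) r = s.
Proof.
move=> pr ps ts eq_rs; apply: (irr_sorted_eq ltn_trans ltnn).
- by rewrite (sorted_pairwise ltn_trans); apply: subseq_pairwise (filter_subseq _ _) pr.
- by rewrite (sorted_pairwise ltn_trans).
move=> x; rewrite mem_filter; have [tx|ntx] := boolP (in_triple a x).
  by apply: eq_rs; move: tx; rewrite /in_triple !inE; lia.
by apply/esym/negbTE; apply: contra ntx => /(allP ts).
Qed.

Lemma flippable_rows a t : is_tableau t -> uniq (flatten t) -> flippable a t ->
  exists t0 t1 t', [/\ t = [:: t0, t1 & t'], outside a (flatten t') &
    (middle_below a t ->
       filter (in_triple a) t0 = [:: a; a.+2] /\ filter (in_triple a) t1 = [:: a.+1]) /\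
    (last_below a t ->
       filter (in_triple a) t0 = [:: a; a.+1] /\ filter (in_triple a) t1 = [:: a.+2])].
Proof.
move=> tab ut ft; case: t tab ut ft => [|t0 [|t1 t']] tab ut ft.
- by case/orP: ft => /and3P[].
- by case/orP: ft => /and3P[] //=.
exists t0, t1, t'; split=> //.
  apply/outsideP; move: ut; rewrite /= catA cat_uniq => /and3P[_ /hasPn h _].
  have h' x : x \in t0 ++ t1 -> x \notin flatten t' by move=> xt; apply/negP => /h; rewrite xt.
  by case/orP: ft => /and3P[/= m0 m1 m2]; split; apply: h'; rewrite mem_cat ?m0 ?m1 ?m2 ?orbT.
move: tab; rewrite !is_tableau_cons => /and4P[_ p0 _ /and4P[_ p1 _ _]].
move: ut; rewrite /= catA cat_uniq => /and3P[+ _ _]; rewrite cat_uniq => /and3P[_ /hasPn dis _].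
have dis0 x : x \in t1 -> (x \in t0) = false by move=> /dis /negbTE.
have dis1 x : x \in t0 -> (x \in t1) = false by move=> xt; apply/negP => /dis; rewrite xt.
split=> /and3P[/= m0 m1 m2]; split;
  apply: filter_triple_row => //; rewrite /= ?/in_triple; try lia;
  move=> x; rewrite !inE => /or3P[] /eqP ->;
  rewrite ?m0 ?m1 ?m2 ?(dis0 _ m1) ?(dis1 _ m0) ?(dis1 _ m1) ?(dis1 _ m2) ?(dis0 _ m2); lia.
Qed.

Lemma row_word_flip a t : row_word (flip_tableau a t) = map (swap_succ a.+1) (row_word t).
Proof. by rewrite /row_word /flip_tableau -map_rev map_flatten. Qed.

Lemma pattern_row_word a t : is_tableau t -> uniq (flatten t) ->
  (middle_below a t -> filter (in_triple a) (row_word t) = [:: a.+1; a; a.+2]) /\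
  (last_below a t -> filter (in_triple a) (row_word t) = [:: a.+2; a; a.+1]).
Proof.
move=> tab ut; split=> type; have ft : flippable a t by rewrite /flippable type ?orbT.
  have [t0 [t1 [t' [tE out [types _]]]]] := flippable_rows tab ut ft.
  have [f0 f1] := types type; rewrite tE !row_word_cons !filter_cat f0 f1 filter_outside //.
  by rewrite /outside (perm_all _ (perm_row_word t')).
have [t0 [t1 [t' [tE out [_ types]]]]] := flippable_rows tab ut ft.
have [f0 f1] := types type; rewrite tE !row_word_cons !filter_cat f0 f1 filter_outside //.
by rewrite /outside (perm_all _ (perm_row_word t')).
Qed.

Lemma dual_knuth_row_word a t : is_tableau t -> uniq (flatten t) -> flippable a t ->
  dual_knuth a (row_word t) = row_word (flip_tableau a t).
Proof.
move=> tab ut ft; rewrite row_word_flip /dual_knuth /triple_map.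
have [mid last] := pattern_row_word a tab ut.
by case/orP: ft => [/mid|/last] ->; rewrite !inE eqxx ?orbT.
Qed.

Lemma is_tableau_flip a t : is_tableau t -> uniq (flatten t) -> flippable a t ->
  is_tableau (flip_tableau a t).
Proof.
move=> tab ut ft.
have n1 : a.+1 \in [:: a; a.+2] = false by rewrite !inE; lia.
have n2 : a.+2 \in [:: a; a.+1] = false by rewrite !inE; lia.
have n3 : a.+2 \in [:: a.+1] = false by rewrite !inE; lia.
have n4 : a.+1 \in [:: a.+2] = false by rewrite !inE; lia.
have t1x : in_triple a a.+1 by rewrite /in_triple; lia.
have t2x : in_triple a a.+2 by rewrite /in_triple; lia.
have t0x : in_triple a a by rewrite /in_triple; lia.
have [t0 [t1 [t' [tE out types]]]] := flippable_rows tab ut ft.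
have map_incr r : pairwise ltn r -> ~~ ((a.+1 \in r) && (a.+2 \in r)) ->
    pairwise ltn (map (swap_succ a.+1) r).
  move=> pr nr; rewrite pairwise_map.
  apply: (sub_in_pairwise (P := mem r) _ _ pr); last by apply/allP.
  move=> x y xr yr xy /=; by apply: swap_succ_ltn => //; apply: contra nr => /andP[/eqP <- /eqP <-]; rewrite xr yr.
have map_above r1 r2 : row_above r1 r2 ->
    (forall i, i < size r2 -> ~~ ((nth 0 r1 i == a.+1) && (nth 0 r2 i == a.+2))) ->
    row_above (map (swap_succ a.+1) r1) (map (swap_succ a.+1) r2).
  move=> /row_aboveP[le_sz cols] h; apply/row_aboveP; rewrite !size_map; split=> // i lt_i.
  by rewrite !(nth_map 0) ?(leq_trans lt_i) //; apply: swap_succ_ltn; [apply: cols|apply: h].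
have [no12 col01 p2] : [/\ ~~ ((a.+1 \in t0) && (a.+2 \in t0)),
    forall i, i < size t1 -> ~~ ((nth 0 t0 i == a.+1) && (nth 0 t1 i == a.+2))
    & ~~ ((a.+1 \in t1) && (a.+2 \in t1))].
  have mem_tri r x : in_triple a x -> (x \in r) = (x \in filter (in_triple a) r).
    by move=> tx; rewrite mem_filter tx.
  move: tab; rewrite tE !is_tableau_cons => /and4P[_ p0 ab tab1].
  case/orP: ft types => type [types1 types2]; [have [f0 f1] := types1 type|have [f0 f1] := types2 type]; split.
  - by rewrite (mem_tri t0) // f0 n1.
  - move=> i lt_i; apply/negP => /andP[/eqP e1 _].
    have : a.+1 \in t0 by rewrite -e1; apply: mem_nth; apply: leq_trans lt_i (row_aboveP _ _ ab).1.
    by rewrite (mem_tri t0) // f0 n1.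
  - by rewrite andbC (mem_tri t1) // f1 n3.
  - by rewrite andbC (mem_tri t0) // f0 n2.
  - move=> i lt_i; apply/negP => /andP[/eqP e1 /eqP e2].
    (* The entry below [a] would lie strictly between [a] and [a+2]. *)
    have at0 : a \in t0 by rewrite (mem_tri t0) // f0 mem_head.
    have [le_sz cols] := row_aboveP _ _ ab.
    have /pairwiseP-/(_ 0) incr0 := p0.
    have /pairwiseP-/(_ 0) incr1 : pairwise ltn t1 by case/and4P: tab1.
    set j := index a t0; have jE : nth 0 t0 j = a by apply: nth_index.
    have lt_j : j < size t0 by rewrite index_mem.
    have lt_ji : j < i.
      rewrite ltnNge leq_eqVlt; apply/negP => /predU1P[eji|lt_ij]; first by move: e1; rewrite eji jE => /n_Sn.
      by have := incr0 i j (leq_trans lt_i le_sz) lt_j lt_ij; rewrite jE e1 /= ltnNge leqnSn.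
    have lt_j1 : j < size t1 by apply: ltn_trans lt_i.
    have := incr1 j i lt_j1 lt_i lt_ji; have := cols j lt_j1; rewrite jE e2 /= => lt1 lt2.
    have : a.+1 \in t1 by apply/(nthP 0); exists j => //; apply/eqP; rewrite eqn_leq lt1 andbT.
    by rewrite (mem_tri t1) // f1 n4.
  - by rewrite (mem_tri t1) // f1 n4.
have flip_out : flip_tableau a t' = t'.
  apply: map_id_in => r rt'; have /outsideP[_ h1 h2] := out.
  apply: map_swap_succ_id; [apply: contra h1|apply: contra h2] => xr; apply/flattenP; by exists r.
rewrite tE /= -/(flip_tableau a t') flip_out.
have h12 r2 : r2 \in t' -> (a.+1 \notin r2) * (a.+2 \notin r2).
  move=> rt; have /outsideP[_ h1 h2] := out.
  by split; [apply: contra h1|apply: contra h2] => xr; apply/flattenP; exists r2.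
move: tab; rewrite tE !is_tableau_cons.
case/and4P=> t00 p0 ab01 /and4P[t10 p1 ab12 ->].
rewrite -!size_eq0 !size_map !size_eq0 t00 t10 !map_incr // map_above //= andbT.
case: t' {tE out flip_out} h12 ab12 => [|r2 t'] // h12 ab12.
have [h1 h2] := h12 r2 (mem_head _ _).
have := map_above _ _ ab12; rewrite (map_swap_succ_id h1 h2); apply=> i lt_i.
by apply/negP => /andP[_ /eqP e2]; case/negP: h2; rewrite -e2 mem_nth.
Qed.

Lemma rs_tableau_dual_knuth a w : uniq w -> flippable a (rs_tableau w) ->
  rs_tableau (dual_knuth a w) = flip_tableau a (rs_tableau w).
Proof.
move=> uw fw; have [tabw pw plw] := rs_tableau_spec uw.
have utw : uniq (flatten (rs_tableau w)) by rewrite (perm_uniq pw).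
rewrite (rs_tableau_plactic (dual_knuth_plactic a uw plw)) dual_knuth_row_word //.
by rewrite rs_tableau_row_word // is_tableau_flip.
Qed.

Lemma perm_flip a t : uniq (flatten t) -> flippable a t ->
  perm_eq (flatten (flip_tableau a t)) (flatten t).
Proof.
move=> ut ft; rewrite /flip_tableau -map_flatten; apply: uniq_perm => //.
  by rewrite map_inj_uniq //; apply: inv_inj; apply: swap_succK.
have mem_row i x : x \in nth [::] t i -> x \in flatten t.
  move=> xr; have [lt_i|ge_i] := ltnP i (size t); last by rewrite nth_default in xr.
  by apply/flattenP; exists (nth [::] t i); rewrite // mem_nth.
have [m1 m2] : a.+1 \in flatten t /\ a.+2 \in flatten t.
  by case/orP: ft => /and3P[_ m1 m2]; split;
    first [exact: mem_row m1|exact: mem_row m2].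
move=> x; rewrite mem_map_swap_succ /swap_succ.
by case: eqP => [->|_]; [rewrite m1|case: eqP => [->|//]; rewrite m1].
Qed.

Lemma inner_tableau_flip k a t : a.+2 <= k ->
  inner_tableau k (flip_tableau a t) = flip_tableau a (inner_tableau k t).
Proof.
move=> ak; rewrite /inner_tableau /flip_tableau.
have filter_swap r : filter (leq^~ k) (map (swap_succ a.+1) r) =
    map (swap_succ a.+1) (filter (leq^~ k) r).
  rewrite filter_map; congr (map _ _); apply: eq_filter => x /=.
  by rewrite /swap_succ; do ?[case: ifP => ?]; lia.
elim: t => //= r t IH; rewrite filter_swap.
by case: (filter _ r) => //= x s; rewrite IH.
Qed.

Lemma pairwise_ltn_split k r : pairwise ltn r ->
  r = filter (leq^~ k) r ++ filter (ltn k) r.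
Proof.
elim: r => //= x r IH /andP[xr pr]; case: (leqP x k) => xk /=; first by rewrite -IH.
have -> : filter (leq^~ k) r = [::].
  apply/eqP; rewrite -(negbK (_ == _)) -has_filter -all_predC.
  by apply: sub_all xr => y /=; lia.
by rewrite /=; congr (_ :: _); rewrite (all_filterP _) //; apply: sub_all xr => y /=; lia.
Qed.

Lemma nth_inner_cat k R T i : is_tableau T -> size R = 2 -> [::] \notin R ->
  inner_tableau k T = R -> nth [::] T i = nth [::] R i ++ filter (ltn k) (nth [::] T i).
Proof.
case: R => [|r0 [|r1 [|? ?]]] // tab _; rewrite !inE negb_or ![[::] == _]eq_sym.
case/andP=> r00 r10 /(inner_tableau_two_rows _ tab r00 r10)[<- <- no3].
case: i => [|[|i]] /=; try exact: pairwise_ltn_split (tableau_nth_row _ tab).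
rewrite nth_nil /=; apply/esym/all_filterP/allP => x xT /=.
rewrite ltnNge; apply/negP => xk.
case: (T) tab no3 xT => [|t0 [|t1 [|t2 t]]] //=; rewrite ?nth_nil //.
rewrite !is_tableau_cons -is_tableau_cons => /and4P[_ _ _ /and4P[_ _ _ tab]] no3.
case: i => [|i] /= xT; first by case/hasP: no3; exists x.
case/hasP: (no_small_below tab no3); exists x => //; apply/flattenP.
exists (nth [::] t i) => //; apply: mem_nth; rewrite ltnNge; apply/negP => ge_i.
by rewrite nth_default in xT.
Qed.

Lemma inner_translationE k R R' T : is_tableau T -> size R = 2 -> [::] \notin R ->
  inner_tableau k T = R ->
  inner_translation R R' T =
  mkseq (fun i => nth [::] R' i ++ filter (ltn k) (nth [::] T i)) (size T).
Proof.
move=> tab R2 R0 inT; apply: eq_map => i; congr (_ ++ _).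
by rewrite {1}(nth_inner_cat i tab R2 R0 inT) drop_size_cat.
Qed.

Lemma inner_translation_id k R T : is_tableau T -> size R = 2 -> [::] \notin R ->
  inner_tableau k T = R -> inner_translation R R T = T.
Proof.
move=> tab R2 R0 inT; rewrite (inner_translationE _ tab R2 R0 inT).
rewrite (eq_mkseq (_ : _ =1 nth [::] T)) ?mkseq_nth // => i.
by rewrite -(nth_inner_cat i tab R2 R0 inT).
Qed.

Lemma inner_translation_comp R R' R'' T :
  inner_translation R' R'' (inner_translation R R' T) = inner_translation R R'' T.
Proof.
rewrite /inner_translation size_map size_iota; apply/eq_in_map => i.
rewrite mem_iota add0n /= => lt_i.
by rewrite (nth_map 0) ?size_iota // nth_iota // drop_size_cat.
Qed.

Lemma inner_translation_flip k a R T : is_tableau T -> size R = 2 -> [::] \notin R ->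
  inner_tableau k T = R -> a.+2 <= k ->
  inner_translation R (flip_tableau a R) T = flip_tableau a T.
Proof.
move=> tab R2 R0 inT ak; rewrite (inner_translationE _ tab R2 R0 inT).
rewrite -[RHS](mkseq_nth [::]) size_map; apply: eq_mkseq => i.
rewrite !nth_flip {2}(nth_inner_cat i tab R2 R0 inT) map_cat; congr (_ ++ _).
by rewrite map_swap_succ_id // mem_filter /= negb_and -leqNgt ?ak // ltnW.
Qed.


(** * Exchanges seen through a dual Knuth transformation *)

Lemma cat_cons_cases (T : Type) (s1 s2 s3 s4 : seq T) x y : s1 ++ x :: s2 = s3 ++ y :: s4 ->
  [\/ s1 = s3 /\ x = y, exists s, s3 = s1 ++ x :: s /\ s2 = s ++ y :: s4
    | exists s, s1 = s3 ++ y :: s /\ s4 = s ++ x :: s2].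
Proof.
elim: s1 s3 => [|z s1 IH] [|z3 s3] /=.
- by case=> -> _; constructor 1.
- by case=> -> ->; constructor 2; exists s3.
- by case=> -> <-; constructor 3; exists s1.
case=> -> /IH[[-> ->]|[s [-> ->]]|[s [-> ->]]].
- by constructor 1.
- by constructor 2; exists s.
- by constructor 3; exists s.
Qed.

Lemma mem_head_row_insert x y t : y \in head [::] (row_insert x t) ->
  y = x \/ y \in head [::] t.
Proof.
case: t => [|r t]; first by rewrite row_insert_nil /= inE => /eqP; left.
rewrite /row_insert; case: ifP => [lt_i|_] /=.
  move=> /(nthP 0)[j]; rewrite size_set_nth (maxn_idPr lt_i) => lt_j.
  by rewrite nth_set_nth /=; case: eqP => _ <-; [left|right; apply: mem_nth].
by rewrite mem_rcons inE => /predU1P.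
Qed.

Lemma mem_head_insert_word y w t : y \in head [::] (insert_word t w) -> y \notin w ->
  y \in head [::] t.
Proof.
elim: w t => [|x w IH] t //= /IH h; rewrite inE negb_or => /andP[yx /h].
by case/mem_head_row_insert => // /eqP; rewrite (negbTE yx).
Qed.

(** As long as [y0] is not bumped from the first row, the insertion does not
    distinguish it from a letter [y] that compares in the same way with the
    other letters. *)
Lemma insert_same_order p q y0 : uniq (p ++ y0 :: q) ->
  y0 \in head [::] (rs_tableau (p ++ y0 :: q)) ->
  exists Q M t, rs_tableau (p ++ y0 :: q) = (Q ++ y0 :: M) :: t /\
   forall y, {in p ++ q, forall e, e != y /\ (e < y) = (e < y0)} ->
     rs_tableau (p ++ y :: q) = (Q ++ y :: M) :: t.
Proof.
elim/last_ind: q => [|q b IH] upq y0h.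
  have up : uniq p by move: upq; rewrite cat_uniq => /and3P[].
  have y0p : y0 \notin p by move: upq; rewrite cat_uniq /= orbF => /and3P[].
  have [tab pP _] := rs_tableau_spec up.
  have memP r : r \in rs_tableau p -> {subset r <= p}.
    by move=> rP e er; rewrite -(perm_mem pP); apply/flattenP; exists r.
  rewrite cats1 rs_tableau_rcons; case tE: (rs_tableau p) tab memP => [|r t] tab memP.
    exists [::], [::], [::]; split=> // y _.
    by rewrite cats1 rs_tableau_rcons tE.
  move: tab; rewrite is_tableau_cons => /and4P[_ pr _ _].
  have rp := memP r (mem_head _ _).
  have [|[ry0 ->]|[p1 [b [q1 [[rE p1y0 y0b _] ->]]]]] := @row_insert_cases y0 r t pr.
  - by apply: contra y0p; apply: rp.
  - exists r, [::], t; rewrite cats1; split=> // y same.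
    rewrite cats1 rs_tableau_rcons tE row_insert_end ?cats1 //.
    apply/allP => e er /=; apply: ltnW; rewrite (same e _).2 ?mem_cat ?rp //.
    exact: (allP ry0).
  exists p1, q1, (row_insert b t); split=> // y same.
  rewrite cats1 rs_tableau_rcons tE rE row_insert_bump //.
    apply/allP => e er /=; apply: ltnW; rewrite (same e _).2; first exact: (allP p1y0).
    by rewrite mem_cat rp // rE mem_cat er.
  have [|ney] := same b; first by rewrite mem_cat rp // rE mem_cat inE eqxx orbT.
  by rewrite [b < y0]ltnNge (ltnW y0b) /= => /negbT; rewrite -leqNgt leq_eqVlt eq_sym (negbTE ney).
have [upq' bpq] : uniq (p ++ y0 :: q) /\ b \notin p ++ y0 :: q.
  by move: upq; rewrite -rcons_cons -rcons_cat rcons_uniq => /andP[].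
have y0h' : y0 \in head [::] (rs_tableau (p ++ y0 :: q)).
  move: y0h; rewrite -rcons_cons -rcons_cat rs_tableau_rcons => /mem_head_row_insert[y0b|//].
  by move: bpq; rewrite y0b mem_cat mem_head orbT.
have [Q [M [t [PE same]]]] := IH upq' y0h'.
have [tab pP _] := rs_tableau_spec upq'.
have pr : pairwise ltn (Q ++ y0 :: M).
  by move: tab; rewrite PE is_tableau_cons => /and4P[].
have bQM : b \notin Q ++ y0 :: M.
  by apply: contra bpq => bQ; rewrite -(perm_mem pP) PE /= mem_cat bQ.
move: y0h; rewrite -rcons_cons -rcons_cat rs_tableau_rcons PE.
have same' y : {in p ++ rcons q b, forall e, e != y /\ (e < y) = (e < y0)} ->
    [/\ rs_tableau (p ++ y :: rcons q b) = row_insert b ((Q ++ y :: M) :: t),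
        b != y & (b < y) = (b < y0)].
  move=> sm; rewrite -rcons_cons -rcons_cat rs_tableau_rcons same.
    by have [] := sm b; rewrite // mem_cat mem_rcons mem_head orbT.
  by move=> e epq; apply: sm; move: epq; rewrite !mem_cat mem_rcons inE => /orP[] ->; rewrite ?orbT.
have [[lt_b ->]|[p1 [c [q1 [[rE p1b bc _] ->]]]]] := row_insert_cases t pr bQM.
  move=> _; exists Q, (rcons M b), t; rewrite rcons_cat; split=> // y /same'[-> nby yb].
  rewrite row_insert_end; first by rewrite rcons_cat.
  move: lt_b; rewrite !all_cat /= => /and3P[Qb y0b Mb].
  have {}y0b : y < b.
    by move: yb; rewrite [b < y0]ltnNge (ltnW y0b) /= => /negbT; rewrite -leqNgt leq_eqVlt eq_sym (negbTE nby).
  rewrite (ltnW y0b); apply/and3P; split=> //; [apply: sub_all Qb|apply: sub_all Mb] => e; exact: ltnW.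
have p1b' : all (leq^~ b) p1 by apply: sub_all p1b => e; apply: ltnW.
have [[QE y0c]|[s [p1E ME]]|[s [QE q1E]]] := cat_cons_cases rE.
- have : uniq (p1 ++ c :: q1).
    by rewrite -rE; apply: (sorted_uniq ltn_trans ltnn); rewrite (sorted_pairwise ltn_trans).
  rewrite /= -y0c cat_uniq /= negb_or => /and4P[_ /andP[y0p1 _] y0q1 _].
  rewrite mem_cat inE (negbTE y0p1) (negbTE y0q1) orbF /= => /eqP y0b.
  by move: bpq; rewrite -y0b mem_cat mem_head orbT.
- move=> _; exists Q, (s ++ b :: q1), (row_insert c t).
  rewrite p1E -catA; split=> // y /same'[-> nby yb].
  rewrite ME (@row_insert_bumpE b _ (Q ++ y :: s) c q1) -?catA //.
  move: p1b p1b'; rewrite p1E !all_cat /= => /and3P[_ y0b _] /and3P[-> _ ->].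
  rewrite andbT /= ltnW //.
  by move: yb; rewrite [b < y0]ltnNge (ltnW y0b) /= => /negbT; rewrite -leqNgt leq_eqVlt eq_sym (negbTE nby).
- move=> _; exists (p1 ++ b :: s), M, (row_insert c t).
  rewrite q1E -catA; split=> // y /same'[-> _ _].
  by rewrite QE (@row_insert_bumpE b _ p1 c (s ++ y :: M)) -?catA.
Qed.
(** Here [r] is the first row of the insertion tableau. A letter smaller than all
    others, inserted first, is never bumped, so it ends in front of [r]. *)
Lemma plactic_last_row w : uniq w -> exists s r,
  [/\ pairwise ltn r, plactic w (s ++ r), w != [::] -> r != [::]
    & forall x, all (ltn x) w -> plactic (x :: w) (s ++ x :: r)].
Proof.
elim/last_ind: w => [_|w y IH]; first by exists [::], [::].
rewrite rcons_uniq => /andP[yw uw]; have [s [r [pr wE _ minE]]] := IH uw.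
have rw e : e \in r -> e \in w by move=> er; rewrite (perm_mem (plactic_perm wE)) mem_cat er orbT.
have yr : y \notin r by apply: contra yw; apply: rw.
have [[ry _]|[p [b [q [[rE py yb bq] _]]]]] := row_insert_cases [::] pr yr.
  exists s, (rcons r y); split.
  - by rewrite -cats1 pairwise_cat allrel1r ry pr.
  - by rewrite -!cats1 catA; apply: plactic_cat2r.
  - by case: (r).
  move=> x; rewrite all_rcons => /andP[_ /minE h].
  by rewrite -rcons_cons -rcons_cons -rcons_cat -!cats1; apply: plactic_cat2r.
exists (rcons s b), (p ++ y :: q); split.
- move: pr; rewrite rE !pairwise_cat /= !allrel_consr py => /and4P[/andP[_ ->] -> _ ->].
  by rewrite /= andbT; apply: sub_all bq => e; apply: ltn_trans.
- rewrite -cats1 wE rE cat_rcons -!catA /=; apply: plactic_cat2l.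
  by apply: row_bump; rewrite // -rE.
- by case: (p).
move=> x; rewrite all_rcons => /andP[xy xw].
rewrite -cats1; apply: plactic_trans (plactic_cat2r [:: y] (minE x xw)) _.
rewrite rE cat_rcons -!catA /= -!catA /=; apply: plactic_cat2l.
apply: (@row_bump y b (x :: p) q) => /=; [by apply/andP|by []|].
rewrite -rE pr andbT; apply/allP => e er; exact: (allP xw) (rw e er).
Qed.

(** The mirror image of the previous lemma, for the first column. *)
Lemma plactic_first_column w : uniq w -> w != [::] -> exists d e s,
  [/\ pairwise ltn (e :: d), plactic w (rev d ++ e :: s)
    & forall x, all (ltn x) w -> plactic (rcons w x) (rev d ++ [:: e, x & s])].
Proof.
move=> uw w0; have [|s [r [pr wE r0 minE]]] := @plactic_last_row (rev w); first by rewrite rev_uniq.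
have {r0} : r != [::] by apply: r0; rewrite -size_eq0 size_rev size_eq0.
case: r pr wE minE => // e d pr wE minE _; exists d, e, (rev s); split=> //.
  rewrite -(revK w); apply: plactic_trans (plactic_rev wE) _.
  by rewrite rev_cat rev_cons cat_rcons.
move=> x xw; have {}/minE h : all (ltn x) (rev w) by rewrite all_rev.
rewrite -(revK (rcons w x)) rev_rcons; apply: plactic_trans (plactic_rev h) _.
by rewrite rev_cat !rev_cons !cat_rcons.
Qed.

(** The reversal of [row_bump_tail]. *)
Lemma plactic_cross_column x d e s : pairwise ltn (e :: d) -> x < e ->
  plactic (x :: rev d ++ e :: s) (rev d ++ [:: x, e & s]).
Proof.
move=> pd xe; have /plactic_rev := row_bump_tail xe pd.
rewrite -cat_cons rev_cat !rev_cons /= -!cats1 -!catA /= => h.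
by have := plactic_cat2r s h; rewrite /= -!catA.
Qed.

Lemma all_ltn_trans x y s : x < y -> all (ltn y) s -> all (ltn x) s.
Proof. by move=> xy; apply: sub_all => z; apply: ltn_trans. Qed.

Lemma weak_le_cat p u v q : weak_le u v -> weak_le (p ++ u ++ q) (p ++ v ++ q).
Proof.
elim=> {u v} [u v uv|u v [p' q' a b ab]|u v w _ h1 _ h2].
- by apply: WeakPlactic; apply: plactic_cat2l; apply: plactic_cat2r.
- by have := WeakCover (@WeakStep (p ++ p') (q' ++ q) a b ab); rewrite -!catA.
- exact: WeakTrans h1 h2.
Qed.

(** Split off the first column of [w], formed by its least letter [e] and the
    larger letters [d]. Both sides reduce to words that agree except for one
    exchange of [a+2] and [e]. *)
Lemma weak_le_231_213 a w : uniq w -> all (ltn a.+2) w ->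
  weak_le ([:: a.+1, a.+2 & w] ++ [:: a]) ([:: a.+1, a & w] ++ [:: a.+2]).
Proof.
move=> uw w2; have [->|w0] := eqVneq w [::].
  by apply: WeakPlactic; symmetry; apply: knuth_yxz.
have [d [e [s [pd wE minE]]]] := plactic_first_column uw w0.
have w1 : all (ltn a) w by apply: all_ltn_trans w2.
have e2 : a.+2 < e.
  by apply: (allP w2); rewrite (perm_mem (plactic_perm wE)) mem_cat mem_head orbT.
have pd2 x : x < e -> pairwise ltn (x :: d).
  move=> xe; move: pd => /= /andP[de ->]; rewrite andbT; exact: all_ltn_trans de.
have [e0 e1] : a < e /\ a.+1 < e by split; lia.
have lhs : plactic ([:: a.+1, a.+2 & w] ++ [:: a]) (rev d ++ [:: a.+1, a, a.+2, e & s]).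
  rewrite /= cats1 (minE a w1) (plactic_cross_column (a :: s) pd e2).
  have -> : plactic [:: a.+2, e, a & s] [:: a.+2, a, e & s] by symmetry; apply: knuth_yxz.
  rewrite (plactic_cross_column _ (pd2 _ e2)) //.
  apply: plactic_cat2l; symmetry; exact: knuth_yxz.
have rhs : plactic ([:: a.+1, a & w] ++ [:: a.+2]) (rev d ++ [:: a.+1, a, e, a.+2 & s]).
  rewrite /= cats1 (minE a.+2 w2) (plactic_cross_column (a.+2 :: s) pd e0).
  (* The move is made on both sides of the goal at once. *)
  have -> : plactic [:: a, e, a.+2 & s] [:: e, a, a.+2 & s] by apply: knuth_xzy; lia.
  by rewrite (plactic_cross_column _ pd e1).
apply: WeakTrans (WeakPlactic lhs) (WeakTrans _ (WeakPlactic (plactic_sym rhs))).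
by have := WeakCover (@WeakStep (rev d ++ [:: a.+1; a]) s _ _ e2); rewrite -!catA.
Qed.

(** The two words insert [a], [a+1] into a first row [q, a+2, r], and [a+2], [a+1]
    into a first row [q, a, r]. Both insertions end with the same first row, and
    they eject [a+2] and the first letter of [r] in opposite orders. *)
Lemma weak_le_312_132 a q r : pairwise ltn (q ++ a :: r) -> all (ltn a.+2) r ->
  weak_le (q ++ a.+2 :: r ++ [:: a; a.+1]) (q ++ a :: r ++ [:: a.+2; a.+1]).
Proof.
move=> pqr r2; have pq : all (ltn^~ a) q.
  by move: pqr; rewrite pairwise_cat allrel_consr => /and3P[/andP[]].
have pq' x : a <= x -> all (ltn^~ x) q.
  by move=> ax; apply: sub_all pq => y /= ya; apply: leq_trans ya ax.
have incr x : a <= x -> x <= a.+2 -> pairwise ltn (q ++ x :: r).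
  move=> ax x2; move: pqr; rewrite !pairwise_cat /= !allrel_consr.
  case/and4P=> /andP[_ ->] -> _ ->; rewrite pq' //= andbT; apply: sub_all r2 => y; exact: leq_ltn_trans.
case: r r2 pqr incr => [|m r] r2 pqr incr.
  by apply: WeakPlactic; apply: plactic_cat2l; symmetry; apply: knuth_xzy.
have m2 : a.+2 < m by case/andP: r2.
have qa x : a < x -> all (ltn^~ x) (q ++ [:: a]) by move=> ax; rewrite all_cat pq' ?(ltnW ax) //= ax.
have incr_m : pairwise ltn ((q ++ [:: a]) ++ m :: r) by rewrite -catA.
have incr_2 : pairwise ltn ((q ++ [:: a]) ++ a.+2 :: r).
  have r2' : all (ltn a.+2) r by case/andP: r2.
  have := incr_m; rewrite !(pairwise_cat ltn (q ++ _)).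
  case/and3P=> qr -> /andP[_ pr'].
  have pr : pairwise ltn r by [].
  rewrite pairwise_cons r2' pr !andbT.
  by move: qr; rewrite !allrel_consr => /andP[_ ->]; rewrite qa.
have lhs : plactic (q ++ a.+2 :: (m :: r) ++ [:: a; a.+1]) ([:: a.+2, m & q] ++ [:: a, a.+1 & r]).
  have := plactic_cat2r [:: a.+1] (row_bump pq (ltnW (ltnSn a.+1)) (incr a.+2 (leqW (leqnSn a)) (leqnn _))).
  rewrite -!catA /= -!catA /= => ->; apply: (@plactic_cat2l [:: a.+2]).
  by have := row_bump (qa _ (ltnSn a)) (ltnW m2) incr_m; rewrite -!catA.
have rhs : plactic (q ++ a :: (m :: r) ++ [:: a.+2; a.+1]) ([:: m, a.+2 & q] ++ [:: a, a.+1 & r]).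
  have := plactic_cat2r [:: a.+1] (row_bump (qa _ (ltnW (ltnSn a.+1))) m2 incr_m).
  rewrite -!catA /= -!catA /= => ->; apply: (@plactic_cat2l [:: m]).
  by have := row_bump (qa _ (ltnSn a)) (ltnSn a.+1) incr_2; rewrite -!catA.
apply: WeakTrans (WeakPlactic lhs) (WeakTrans _ (WeakPlactic (plactic_sym rhs))).
exact: (WeakCover (@WeakStep [::] _ _ _ m2)).
Qed.

(** Knuth moves never exchange the letters [c] and [c+1]: the third letter that
    they require would have to lie between them. *)
Lemma filter_consecutive_plactic c u v : plactic u v ->
  filter (pred2 c c.+1) u = filter (pred2 c c.+1) v.
Proof.
elim=> {u v} [u v|//|u v _ ->|u v w _ -> _ ->] //.
have swapE P (y z : nat) s : P y && P z = false ->
    filter P [:: y, z & s] = filter P [:: z, y & s].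
  by move=> /=; case: (P y); case: (P z).
case=> p q x y z xy yz;
  have nxz : pred2 c c.+1 x && pred2 c c.+1 z = false by rewrite /=; lia.
  by rewrite !filter_cat (swapE _ _ _ _ nxz).
rewrite -(cat1s y) -(cat1s y (z :: _)) !catA filter_cat (swapE _ _ _ _ nxz).
by rewrite -filter_cat.
Qed.

Lemma filter_consecutive_row_word a w : uniq w ->
  (middle_below a (rs_tableau w) -> filter (pred2 a a.+1) w = [:: a.+1; a] /\
                                   filter (pred2 a.+1 a.+2) w = [:: a.+1; a.+2]) /\
  (last_below a (rs_tableau w) -> filter (pred2 a a.+1) w = [:: a; a.+1] /\
                                 filter (pred2 a.+1 a.+2) w = [:: a.+2; a.+1]).
Proof.
move=> uw; have [tab pw plw] := rs_tableau_spec uw.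
have ut : uniq (flatten (rs_tableau w)) by rewrite (perm_uniq pw).
have triE c : a <= c <= a.+1 -> filter (pred2 c c.+1) w =
    filter (pred2 c c.+1) (filter (in_triple a) (row_word (rs_tableau w))).
  move=> ac; rewrite (filter_consecutive_plactic c plw) -filter_predI.
  by apply: eq_filter => x; rewrite /= /in_triple; lia.
have [mid last] := pattern_row_word a tab ut.
have e0 : (a == a.+1 = false) * (a == a.+2 = false) * (a.+1 == a = false) * (a.+2 == a = false)
  * (a.+1 == a.+2 = false) * (a.+2 == a.+1 = false) by do !split; lia.
have c0 : a <= a <= a.+1 by rewrite leqnn leqnSn.
have c1 : a <= a.+1 <= a.+1 by rewrite leqnn leqnSn.
by split=> type; rewrite (triE a c0) (triE a.+1 c1); [rewrite mid|rewrite last];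
  rewrite //= !eqxx !e0 /= ?eqxx.
Qed.

Lemma order_in_filter (i j : nat) p q : uniq (p ++ i :: q) -> i != j ->
  (filter (pred2 i j) (p ++ i :: q) = [:: j; i] -> j \in p) /\
  (filter (pred2 i j) (p ++ i :: q) = [:: i; j] -> j \in q).
Proof.
move=> upq ij; have ip : i \notin p.
  by move: upq; rewrite cat_uniq /= negb_or => /and3P[_ /andP[]].
rewrite filter_cat /= eqxx /=; split; case pE: (filter _ p) => [|e s] /= [eE].
- by rewrite eE eqxx in ij.
- by have : e \in filter (pred2 i j) p; [rewrite pE mem_head|rewrite mem_filter -eE => /andP[]].
- by have : j \in filter (pred2 i j) q; [rewrite eE mem_head|rewrite mem_filter => /andP[]].
- have : e \in filter (pred2 i j) p by rewrite pE mem_head.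
  by rewrite mem_filter eE (negbTE ip) andbF.
Qed.

(** If [a+1] is not in the first row, then [a] bumps [a+2] out of it. *)
Lemma first_row_keeps_middle a p q : uniq (p ++ [:: a.+2; a]) -> p != [::] ->
  a.+2 \in head [::] (rs_tableau (p ++ [:: a.+2; a] ++ q)) -> a.+2 \notin q ->
  a.+1 \in head [::] (rs_tableau p).
Proof.
rewrite cat_uniq /= negb_or => /and3P[up /andP[a2p _] _] p0.
rewrite -[p ++ _]/(p ++ [:: a.+2; a] ++ q) catA {1}/rs_tableau insert_word_cat -/(rs_tableau _).
move=> /mem_head_insert_word h /h.
rewrite /rs_tableau insert_word_cat -/(rs_tableau _) /= => {h}.
have [tab pP _] := rs_tableau_spec up.
have : rs_tableau p != [::].
  apply: contraNneq p0 => tE; move: pP; rewrite tE perm_sym => /perm_nilP ->.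
  by [].
case: (rs_tableau p) tab pP => // r t tab pP _ /=.
move: tab; rewrite is_tableau_cons => /and4P[_ pr _ _].
have memr x : x \in r -> x \in p by move=> xr; rewrite -(perm_mem pP) /= mem_cat xr.
have a2r : a.+2 \notin r by apply: contra a2p; apply: memr.
have [Q [M [t2 [-> Q2 M2 Qr]]]] : exists Q M t2, [/\ row_insert a.+2 (r :: t) = (Q ++ a.+2 :: M) :: t2,
    all (ltn^~ a.+2) Q, all (ltn a.+2) M & {subset Q <= r}].
  have [[r2 ->]|[p1 [b [q1 [[rE p12 b2 bq] ->]]]]] := row_insert_cases t pr a2r.
    by exists r, [::], t; rewrite cats1; split.
  exists p1, q1, (row_insert b t); split=> //; first exact: all_ltn_trans bq.
  by move=> x xp; rewrite rE mem_cat xp.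
apply: contraLR => a1r.
have Qa : all (leq^~ a) Q.
  apply/allP => x xQ; have := allP Q2 x xQ => /=; rewrite ltnS leq_eqVlt => /predU1P[xE|//].
  by rewrite -xE Qr in a1r.
rewrite row_insert_bump //= mem_cat inE !negb_or; apply/and3P; split.
- by apply/negP => /(allP Q2); rewrite /= ltnn.
- by lia.
- by apply/negP => /(allP M2); rewrite /= ltnn.
Qed.

(** If the exchanged letters are not [a] and [a+2], then the dual Knuth
    transformation relabels both words by the same map, which keeps the order of
    the exchanged letters. Otherwise, in the placement [middle_below] the letter
    [a+1] stands before them and [weak_le_312_132] applies, and in the placement
    [last_below] it stands after them and [weak_le_231_213] applies. *)
Lemma dual_knuth_weak_step a k u v : uniq u -> weak_step u v -> a.+2 <= k ->
  ~~ has (leq^~ k) (nth [::] (rs_tableau v) 2) ->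
  middle_below a (rs_tableau u) /\ middle_below a (rs_tableau v) \/
  last_below a (rs_tableau u) /\ last_below a (rs_tableau v) ->
  weak_le (dual_knuth a u) (dual_knuth a v).
Proof.
move=> uu st ak no3 types; have uv : uniq v by rewrite -(perm_uniq (weak_step_perm st)).
case: st uu uv no3 types => p q x y xy uu uv no3 types.
have [tri|ntri] := boolP (in_triple a x && in_triple a y); last first.
  have patE : filter (in_triple a) (p ++ [:: y, x & q]) =
              filter (in_triple a) (p ++ [:: x, y & q]).
    by move: ntri; rewrite !filter_cat /=; do 2 case: (in_triple a _).
  have := @triple_map_ltn a p q x y _ xy (or_introl erefl).
  rewrite /dual_knuth patE !map_cat /= => lt_xy.
  by apply: WeakCover; constructor.
have [pairu pairv] := (filter_consecutive_row_word a uu, filter_consecutive_row_word a uv).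
have same c : a <= c <= a.+1 ->
    filter (pred2 c c.+1) (p ++ [:: x, y & q]) = filter (pred2 c c.+1) (p ++ [:: y, x & q]).
  move=> ac; have cE : c = a \/ c = a.+1 by lia.
  case: types => -[tu tv]; first have [[e1 e2] [e3 e4]] := (pairu.1 tu, pairv.1 tv).
    by case: cE => ->; rewrite ?e1 ?e2 ?e3 ?e4.
  have [[e1 e2] [e3 e4]] := (pairu.2 tu, pairv.2 tv).
  by case: cE => ->; rewrite ?e1 ?e2 ?e3 ?e4.
have [xE yE] : x = a /\ y = a.+2.
  have neq c : a <= c <= a.+1 -> x = c -> y <> c.+1.
    move=> /same + xc yc; rewrite !filter_cat xc yc /= !eqxx orbT /= => /eqP.
    rewrite eqseq_cat // eqxx eqseq_cons /=; lia.
  have := neq x; have := neq a; move: tri; rewrite /in_triple; lia.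
rewrite {}xE {}yE {xy tri same} in uu uv no3 types pairu pairv *.
have neq : a != a.+1 by lia.
case: types => -[tu tv].
  have [e1 _] := pairu.1 tu.
  have a1p : a.+1 \in p by apply: (order_in_filter uu neq).1.
  have a2v : a.+2 \in head [::] (rs_tableau (p ++ [:: a.+2; a] ++ q)).
    by case/and3P: tv => _ _; rewrite nth0.
  case/splitPr: p / a1p uu uv a2v {no3 tu tv e1 pairu pairv} => p1 p2 uu uv a2v.
  have : outside a (p1 ++ p2 ++ q) by apply: (perm_outside uu); perm_count.
  rewrite /outside !all_cat => /and3P[out1 out2 outq].
  have outs : all (outside a) [:: p1; p2; [::]; q] by rewrite /= /outside out1 out2 outq.
  rewrite -!catA; have /= -> := dual_knuth_213 outs; have /= -> := dual_knuth_231 outs.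
  have uz z : in_triple a z -> uniq (p1 ++ z :: p2).
    move=> tz; rewrite -cat1s uniq_catCA /=; apply/andP; split.
      by rewrite mem_cat negb_or; apply/andP; split; apply/negP;
        [move/(allP out1)|move/(allP out2)]; rewrite /= tz.
    apply: subseq_uniq uu; apply: subseq_trans (prefix_subseq _ _).
    exact: cat_subseq (subseq_refl _) (subseq_cons _ _).
  have h1 : a.+1 \in head [::] (rs_tableau (p1 ++ a.+1 :: p2)).
    apply: first_row_keeps_middle a2v _.
    - by move: uv; rewrite -(cat1s a.+2) -(cat1s a q) (catA [:: _]) (catA (p1 ++ _)) cat_uniq => /andP[].
    - by case: (p1).
    - by have /outsideP[] := outq.
  have [|Q [M [t [_ sameE]]]] := insert_same_order _ h1; first by apply: uz; rewrite /in_triple; lia.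
  have zE z : in_triple a z -> z != a.+1 ->
      pairwise ltn (Q ++ z :: M) /\ plactic (p1 ++ z :: p2) (row_word t ++ Q ++ z :: M).
    move=> tz nz; have [tab _ pl] := rs_tableau_spec (uz z tz).
    move: tab pl; rewrite (sameE z).
      by rewrite is_tableau_cons row_word_cons => /and4P[].
    move=> e epq; have : ~~ in_triple a e.
      by move: epq; rewrite mem_cat => /orP[/(allP out1)|/(allP out2)].
    by move: tz; rewrite /in_triple; split; lia.
  have [| |pa la] := zE a; [by rewrite /in_triple; lia|exact: neq|].
  have [| |p2' la2] := zE a.+2; [by rewrite /in_triple; lia|by lia|].
  have M2 : all (ltn a.+2) M by move: p2'; rewrite pairwise_cat => /and3P[_ _ /andP[]].
  have := weak_le_cat (row_word t) q (weak_le_312_132 pa M2); rewrite -!catA /= -?catA /= => mid.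
  have lhs := plactic_cat2r [:: a, a.+1 & q] la2.
  have rhs := plactic_cat2r [:: a.+2, a.+1 & q] la.
  move: lhs rhs; rewrite -!catA /= -?catA => lhs rhs.
  exact: WeakTrans (WeakPlactic lhs) (WeakTrans mid (WeakPlactic (plactic_sym rhs))).
have [e1 _] := pairu.2 tu.
have a1q : a.+1 \in q.
  have : a.+1 \in a.+2 :: q by apply: (order_in_filter uu neq).2.
  by rewrite inE => /orP[|//]; lia.
case/splitPr: q / a1q uu uv no3 {tu tv e1 pairu pairv} => q1 q2 uu uv no3.
have out : outside a (p ++ q1 ++ q2) by apply: (perm_outside uu); perm_count.
have [outp [out1 out2]] : outside a p /\ outside a q1 /\ outside a q2.
  by move: out; rewrite /outside !all_cat => /and3P[].
have outs : all (outside a) [:: p; [::]; q1; q2] by rewrite /= outp out1 out2.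
have /= -> := dual_knuth_132 outs; have /= -> := dual_knuth_312 outs.
have q12 : all (ltn a.+2) q1.
  apply/allP => e eq1 /=; have : ~~ in_triple a e by apply: (allP out1).
  suff : ~~ (e < a) by rewrite /in_triple; lia.
  apply: contra no3 => ea; have [tabv _ plv] := rs_tableau_spec uv.
  apply/(has_decreasing_row_word _ tabv)/(has_increasing_plactic _ _ (plactic_rev plv)).
  exists [:: e; a; a.+2]; split=> //=; [|by rewrite ea; lia|by lia].
  rewrite -subseq_rev revK -[rev _]/[:: a.+2; a; e]; apply: subseq_trans (suffix_subseq p _).
  by rewrite /= !eqxx sub1seq mem_cat eq1.
have uq1 : uniq q1 by move: uu; rewrite cat_uniq /= cat_uniq => /and5P[_ _ _ _ /andP[]].
by have := weak_le_cat p q2 (weak_le_231_213 uq1 q12); rewrite /= -!catA.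
Qed.

Lemma inner_tableau_types k a t R : is_tableau t -> size R = 2 -> [::] \notin R ->
  inner_tableau k t = R ->
  (middle_below a R -> middle_below a t) /\ (last_below a R -> last_below a t).
Proof.
case: R => [|r0 [|r1 [|? ?]]] // tab _; rewrite !inE negb_or ![[::] == _]eq_sym.
case/andP=> r00 r10 /(inner_tableau_two_rows _ tab r00 r10)[r0E r1E _].
have sub0 x : x \in r0 -> x \in nth [::] t 0 by rewrite -r0E mem_filter => /andP[].
have sub1 x : x \in r1 -> x \in nth [::] t 1 by rewrite -r1E mem_filter => /andP[].
by split=> /and3P[/= m0 m1 m2]; apply/and3P; split; auto.
Qed.

Lemma inner_tableau_no_third_row k t R : is_tableau t -> size R = 2 -> [::] \notin R ->
  inner_tableau k t = R -> ~~ has (leq^~ k) (nth [::] t 2).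
Proof.
case: R => [|r0 [|r1 [|? ?]]] // tab _; rewrite !inE negb_or ![[::] == _]eq_sym.
by case/andP=> r00 r10 /(inner_tableau_two_rows _ tab r00 r10)[].
Qed.

Lemma dual_knuth_weak_le k a R u v : size R = 2 -> [::] \notin R ->
  flippable a R -> a.+2 <= k -> weak_le u v -> uniq u ->
  inner_tableau k (rs_tableau u) = R -> inner_tableau k (rs_tableau v) = R ->
  weak_le (dual_knuth a u) (dual_knuth a v).
Proof.
move=> R2 R0 fR ak; elim=> {u v} [u v uv uu _ _|u v st uu inu inv|u v w le1 IH1 le2 IH2 uu inu inw].
- by apply: WeakPlactic; apply: dual_knuth_plactic.
- have uv : uniq v by rewrite -(perm_uniq (weak_step_perm st)).
  have [[tabu _ _] [tabv _ _]] := (rs_tableau_spec uu, rs_tableau_spec uv).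
  apply: dual_knuth_weak_step uu st ak _ _; first exact: inner_tableau_no_third_row inv.
  have [mu lu] := inner_tableau_types a tabu R2 R0 inu.
  have [mv lv] := inner_tableau_types a tabv R2 R0 inv.
  by case/orP: fR => type; [left|right]; auto.
have uv : uniq v by rewrite -(perm_uniq (weak_le_perm le1)).
have inv := weak_le_inner_tableau uv le1 le2 R2 R0 inu inw.
exact: WeakTrans (IH1 uu inu inv) (IH2 uv inv inw).
Qed.


(** * Words and permutations *)

Lemma size_one_line n (w : 'S_n) : size (one_line w) = n.
Proof. by rewrite size_map size_enum_ord. Qed.

Lemma nth_one_line n (w : 'S_n) (i : 'I_n) : nth 0 (one_line w) i = (w i).+1.
Proof. by rewrite (nth_map i) ?size_enum_ord // nth_ord_enum. Qed.

Lemma one_line_perm n (w : 'S_n) : perm_eq (one_line w) (iota 1 n).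
Proof.
apply: uniq_perm; rewrite ?iota_uniq //.
  rewrite map_inj_uniq ?enum_uniq // => i j [] /val_inj; exact: perm_inj.
move=> x; rewrite mem_iota add1n ltnS; apply/mapP/andP => [[i _ ->]|[x0 xn]]; first by split; rewrite ?ltn_ord.
have lt_x : x.-1 < n by rewrite prednK.
exists (w^-1%g (Ordinal lt_x)); rewrite ?mem_enum // permKV /= prednK //.
Qed.

Lemma one_line_onto n (u : seq nat) : perm_eq u (iota 1 n) -> exists w : 'S_n, one_line w = u.
Proof.
move=> pu; have szu : size u = n by rewrite (perm_size pu) size_iota.
have bnd (i : 'I_n) : 0 < nth 0 u i <= n.
  have : nth 0 u i \in iota 1 n by rewrite -(perm_mem pu) mem_nth // szu.
  by rewrite mem_iota add1n ltnS.
have lt_pred (i : 'I_n) : (nth 0 u i).-1 < n by case/andP: (bnd i) => h1 h2; rewrite prednK.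
have inj : injective (fun i => Ordinal (lt_pred i)).
  move=> i j [] eq_ij; apply/val_inj/eqP; have : nth 0 u i == nth 0 u j.
    by move: eq_ij; case/andP: (bnd i); case/andP: (bnd j); case: (nth 0 u i) => [|?];
      case: (nth 0 u j) => [|?] //= _ _ _ _ ->.
  by rewrite nth_uniq ?szu // (perm_uniq pu) iota_uniq.
exists (perm inj); apply: (@eq_from_nth _ 0); rewrite size_one_line // => i lt_i.
by rewrite (nth_one_line (perm inj) (Ordinal lt_i)) permE /= prednK //; case/andP: (bnd (Ordinal lt_i)).
Qed.

Lemma val_tperm_succ n (i j x : 'I_n) : val j = i.+1 -> val (tperm i j x) = swap_succ i x.
Proof.
move=> ji; rewrite /swap_succ -ji !val_eqE; case: tpermP => [->|->|/eqP/negbTE -> /eqP/negbTE -> //].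
  by rewrite eqxx.
by rewrite eqxx; case: eqP => // ->.
Qed.

(** Exchanging neighbouring entries in increasing order creates one inversion
    and transports the others. *)
Lemma perm_length_swap n (u : 'S_n) (i j : 'I_n) : val j = i.+1 -> u i < u j ->
  perm_length (tperm i j * u)%g = (perm_length u).+1.
Proof.
move=> ji uij; set t := tperm i j; rewrite /perm_length.
pose f (p : 'I_n * 'I_n) := (t p.1, t p.2).
have fK : involutive f by move=> [p q]; rewrite /f /= !tpermK.
have t_lt (p q : 'I_n) : p < q -> (p, q) != (i, j) -> t p < t q.
  move=> pq ne; rewrite !val_tperm_succ //; apply: swap_succ_ltn => //.
  by rewrite -ji !val_eqE -xpair_eqE.
set I1 := [set _ | _]; set I0 := [set _ | _].
have -> : I1 = (i, j) |: f @: I0.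
  apply/setP => -[p q]; rewrite !inE /=; have [[-> ->]|ne] := eqVneq (p, q) (i, j).
    by rewrite !permM tpermL tpermR uij ji ltnSn.
  rewrite -[X in X \in f @: _](fK (p, q)) mem_imset; last exact: inv_inj.
  rewrite inE /= !permM; have [pq|npq] := boolP (p < q); first by rewrite t_lt.
  apply/esym/negbTE/negP => /andP[tpq inv].
  have [[tp tq]|ne'] := eqVneq (t p, t q) (i, j); first by move: inv; rewrite tp tq; lia.
  by have := t_lt _ _ tpq ne'; rewrite !tpermK (negbTE npq).
rewrite cardsU1 card_imset; last exact: inv_inj.
suff -> : (i, j) \notin f @: I0 by [].
rewrite -[X in X \notin _](fK (i, j)) mem_imset; last exact: inv_inj.
by rewrite inE /f /= tpermL tpermR ji; lia.
Qed.

Lemma one_line_swap n (u : 'S_n) (i j : 'I_n) : val j = i.+1 ->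
  exists p q, [/\ size p = i, one_line u = p ++ [:: (u i).+1, (u j).+1 & q]
    & one_line (tperm i j * u)%g = p ++ [:: (u j).+1, (u i).+1 & q]].
Proof.
move=> ji; have lt_i := ltn_ord i; have lt_j := ltn_ord j; rewrite ji in lt_j.
exists (take i (one_line u)), (drop i.+2 (one_line u)).
have szt : size (take i (one_line u)) = i by rewrite size_takel // size_one_line ltnW.
have splitE : one_line u = take i (one_line u) ++ [:: (u i).+1, (u j).+1 & drop i.+2 (one_line u)].
  by rewrite -!nth_one_line ji -!drop_nth ?size_one_line // cat_take_drop.
split=> //; apply: (@eq_from_nth _ 0).
  have := congr1 size splitE; rewrite !size_cat /= !size_one_line; exact.
move=> k; rewrite size_one_line => lt_k.
rewrite (nth_one_line _ (Ordinal lt_k)) permM nth_cat szt.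
case: tpermP => [ki|kj|/eqP nki /eqP nkj].
- by rewrite -[k]/(val (Ordinal lt_k)) ki ltnn subnn.
- by rewrite -[k]/(val (Ordinal lt_k)) kj ji ltnNge leqnSn subSnn.
have {}nki : k != i by rewrite -val_eqE in nki.
have {}nkj : k != i.+1 by rewrite -val_eqE /= ji in nkj.
rewrite -(nth_one_line u (Ordinal lt_k)) /= {1}splitE nth_cat szt.
case: ltnP => // ge_k; have -> : k - i = (k - i.+2).+2 by lia.
by [].
Qed.

Lemma perm_weak_step_word n (u w : 'S_n) :
  perm_weak_step u w -> weak_step (one_line u) (one_line w).
Proof.
case/existsP=> i /existsP[j /and3P[/eqP ji /eqP wE /eqP len]].
have [p [q [_ uE wE']]] := one_line_swap u ji; rewrite wE wE' uE; constructor.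
rewrite ltnS ltnNge leq_eqVlt; apply/negP => /predU1P[/val_inj/perm_inj eij|uji].
  by move: ji; rewrite eij => /n_Sn.
have := @perm_length_swap n w i j ji; rewrite {1 2}wE !permM tpermL tpermR => /(_ uji).
by rewrite wE mulgA tperm2 mul1g -wE len; lia.
Qed.

Lemma weak_step_perm_word n (u w : 'S_n) :
  weak_step (one_line u) (one_line w) -> perm_weak_step u w.
Proof.
move uE: (one_line u) => s; move wE: (one_line w) => s' st.
case: st uE wE => p q a b ab uE wE.
have sz : size p + (size q).+2 = n by rewrite -(size_one_line u) uE size_cat.
have lt_i : size p < n by lia.
have lt_j : (size p).+1 < n by lia.
pose i := Ordinal lt_i; pose j := Ordinal lt_j; have ji : val j = i.+1 by [].
have ui : (u i).+1 = a by rewrite -nth_one_line uE nth_cat ltnn subnn.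
have uj : (u j).+1 = b by rewrite -nth_one_line uE nth_cat /= ltnNge leqnSn subSnn.
apply/existsP; exists i; apply/existsP; exists j; rewrite ji eqxx /=.
have [p' [q' [szp uE' wE']]] := one_line_swap u ji.
have eq_w : w = (tperm i j * u)%g.
  have one_line_inj (v1 v2 : 'S_n) : one_line v1 = one_line v2 -> v1 = v2.
    move=> e; apply/permP => x; apply/val_inj/succn_inj.
    by rewrite -!nth_one_line e.
  apply: one_line_inj; rewrite wE wE'.
  have /eqP : p ++ [:: a, b & q] = p' ++ [:: (u i).+1, (u j).+1 & q'] by rewrite -uE.
  by rewrite eqseq_cat ?szp // ui uj !eqseq_cons !eqxx /= => /andP[/eqP -> /eqP ->].
have uij : u i < u j by rewrite -ltnS ui uj.
by rewrite eq_w perm_length_swap // !eqxx.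
Qed.

Lemma rs_tableau_SYT n u : perm_eq u (iota 1 n) -> rs_tableau u \in SYT n.
Proof.
move=> pu; have uu : uniq u by rewrite (perm_uniq pu) iota_uniq.
have [tab pP _] := rs_tableau_spec uu.
by rewrite SYT_tableau tab (perm_trans pP pu).
Qed.

Lemma mem_knuth_class n (w : 'S_n) T : (w \in knuth_class n T) = (rs_tableau (one_line w) == T).
Proof. by rewrite inE. Qed.

Lemma weak_le_one_line n (u w : 'S_n) : perm_weak_le u w ->
  weak_le (one_line u) (one_line w).
Proof.
move=> /(@connectP _ (@perm_weak_step n))[s us ->].
elim: s u us => [|v s IH] u /=; first by move=> _; apply: WeakPlactic.
move=> /andP[]  /perm_weak_step_word/WeakCover le_uv /IH; exact: WeakTrans.
Qed.

Lemma tab_weak_le_word n S T : tab_weak_le n S T -> exists u v,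
  [/\ perm_eq u (iota 1 n), rs_tableau u = S, rs_tableau v = T & weak_le u v].
Proof.
elim=> {S T} [S T [_ _ [u [v [uS vT uv]]]]|S M T _ [u [v [pu uS vM uv]]] _ [v' [w [pv' v'M wT vw]]]].
  exists (one_line u), (one_line v); split; first exact: one_line_perm.
  - by move: uS; rewrite mem_knuth_class => /eqP.
  - by move: vT; rewrite mem_knuth_class => /eqP.
  - exact: weak_le_one_line.
have pv : perm_eq v (iota 1 n) by rewrite -(permPl (weak_le_perm uv)).
exists u, w; split=> //; apply: WeakTrans uv (WeakTrans _ vw).
have uniq_perm_iota s : perm_eq s (iota 1 n) -> uniq s.
  by move=> ps; rewrite (perm_uniq ps) iota_uniq.
have [_ _ plv] := rs_tableau_spec (uniq_perm_iota _ pv).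
have [_ _ plv'] := rs_tableau_spec (uniq_perm_iota _ pv').
apply: WeakPlactic; apply: plactic_trans plv _; rewrite vM -v'M.
exact: plactic_sym.
Qed.

Lemma weak_le_tableau n u v : weak_le u v -> perm_eq u (iota 1 n) ->
  tab_weak_le n (rs_tableau u) (rs_tableau v).
Proof.
have step s s' : perm_eq s (iota 1 n) -> perm_eq s' (iota 1 n) ->
    rs_tableau s = rs_tableau s' \/ weak_step s s' ->
    tab_weak_le n (rs_tableau s) (rs_tableau s').
  move=> ps ps' e; apply: t_step; split; try exact: rs_tableau_SYT.
  have [x xs] := one_line_onto ps; have [y ys] := one_line_onto ps'.
  case: e => [e|st].
    by exists x, x; rewrite !mem_knuth_class xs e eqxx; split=> //; apply: connect0.
  exists x, y; rewrite !mem_knuth_class xs ys !eqxx; split=> //.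
  by apply: connect1; apply: weak_step_perm_word; rewrite xs ys.
elim=> {u v} [u v pl pu|u v st pu|u v w le1 IH1 _ IH2 pu].
- apply: (step _ _ pu); last by left; apply: rs_tableau_plactic.
  by rewrite -(permPl (plactic_perm pl)).
- apply: (step _ _ pu); last by right.
  by rewrite -(permPl (weak_step_perm st)).
- by apply: t_trans (IH1 pu) (IH2 _); rewrite -(permPl (weak_le_perm le1)).
Qed.


(** * Inner translation between two-rowed tableaux *)

Definition translates (n k : nat) (R R' : tableau) : Prop :=
  (forall T, T \in SYT_inner n k R -> inner_translation R R' T \in SYT_inner n k R') /\
  (forall S T, S \in SYT_inner n k R -> T \in SYT_inner n k R -> tab_weak_le n S T ->
     tab_weak_le n (inner_translation R R' S) (inner_translation R R' T)).

Lemma translates_trans n k R R' R'' :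
  translates n k R R' -> translates n k R' R'' -> translates n k R R''.
Proof.
move=> [in1 le1] [in2 le2]; split=> [T TR|S T SR TR leST].
  by rewrite -(inner_translation_comp R R'); apply/in2/in1.
rewrite -!(inner_translation_comp R R' R''); apply: le2; [exact: in1|exact: in1|exact: le1].
Qed.

Lemma SYT_innerP n k R T : T \in SYT_inner n k R ->
  [/\ is_tableau T, perm_eq (flatten T) (iota 1 n), uniq (flatten T) & inner_tableau k T = R].
Proof.
rewrite unfold_in SYT_tableau => /andP[/andP[tab pT] /eqP].
by split; rewrite // (perm_uniq pT) iota_uniq.
Qed.

Lemma flippable_bound k a R : R \in SYT k -> flippable a R -> a.+2 <= k.
Proof.
rewrite SYT_tableau => /andP[_ pR] fR.
suff : a.+2 \in flatten R by rewrite (perm_mem pR) mem_iota add1n ltnS => /andP[].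
have mem_row i : a.+2 \in nth [::] R i -> a.+2 \in flatten R.
  move=> xr; have [lt_i|ge_i] := ltnP i (size R); last by rewrite nth_default in xr.
  by apply/flattenP; exists (nth [::] R i); rewrite // mem_nth.
by case/orP: fR => /and3P[_ _]; apply: mem_row.
Qed.

Lemma translates_flip n k a R : R \in SYT k -> size R = 2 -> flippable a R ->
  translates n k R (flip_tableau a R).
Proof.
move=> RS R2 fR; have ak := flippable_bound RS fR.
have R0 : [::] \notin R by move: RS; rewrite SYT_tableau => /andP[/and3P[]].
have typeT T : T \in SYT_inner n k R -> flippable a T.
  case/SYT_innerP=> tab _ _ inT; have [mT lT] := inner_tableau_types a tab R2 R0 inT.
  by case/orP: fR => [/mT|/lT] type; rewrite /flippable type ?orbT.
have flipE T : T \in SYT_inner n k R ->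
    inner_translation R (flip_tableau a R) T = flip_tableau a T.
  by case/SYT_innerP=> tab _ _ inT; apply: inner_translation_flip inT ak.
split=> [T TR|S T SR TR leST]; rewrite !flipE //.
  have fT := typeT T TR; case/SYT_innerP: TR => tab pT uT inT.
  rewrite unfold_in SYT_tableau is_tableau_flip // (perm_trans (perm_flip uT fT) pT) /=.
  by rewrite inner_tableau_flip // inT.
have [u [v [pu uS vT le_uv]]] := tab_weak_le_word leST.
have uu : uniq u by rewrite (perm_uniq pu) iota_uniq.
have uv : uniq v by rewrite -(perm_uniq (weak_le_perm le_uv)).
have [fS fT] := (typeT S SR, typeT T TR).
have [[tabS _ uniqS inS] [_ _ _ inT]] := (SYT_innerP SR, SYT_innerP TR).
rewrite -uS -vT -!rs_tableau_dual_knuth ?uS ?vT //; apply: weak_le_tableau.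
  by apply: (dual_knuth_weak_le R2 R0 fR ak le_uv uu); rewrite ?uS ?vT.
have [_ pS plu] := rs_tableau_spec uu; rewrite uS in pS plu.
apply: perm_trans (plactic_perm (dual_knuth_plactic a uu plu)) _.
rewrite dual_knuth_row_word //; apply: perm_trans (perm_row_word _) _.
exact: perm_trans (perm_flip uniqS fS) (perm_trans pS pu).
Qed.

Lemma shape_flip a R : shape (flip_tableau a R) = shape R.
Proof. by rewrite /shape /flip_tableau -map_comp; apply: eq_map => r /=; rewrite size_map. Qed.

Lemma flip_SYT k a R : R \in SYT k -> flippable a R -> flip_tableau a R \in SYT k.
Proof.
rewrite !SYT_tableau => /andP[tab pR] fR; have uR : uniq (flatten R) by rewrite (perm_uniq pR) iota_uniq.
by rewrite is_tableau_flip // (perm_trans (perm_flip uR fR)).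
Qed.

Lemma ltn_sumn_map (f : nat -> nat) r x : {in r, forall y, f y <= y} -> x \in r -> f x < x ->
  sumn (map f r) < sumn r.
Proof.
elim: r => //= y r IH le_f; rewrite inE.
have le_y : f y <= y by apply: le_f; rewrite mem_head.
have le_r : {in r, forall y, f y <= y} by move=> z zr; apply: le_f; rewrite inE zr orbT.
have le_sum : sumn (map f r) <= sumn r.
  elim: (r) le_r {IH le_f} => //= z s IHs le_s; rewrite leq_add //; first by apply: le_s; rewrite mem_head.
  by apply: IHs => t ts; apply: le_s; rewrite inE ts orbT.
case/predU1P=> [->|xr] lt_x; first by rewrite -addSn leq_add.
by rewrite -addnS leq_add // IH.
Qed.

(** A flip of the placement [last_below] replaces [a+2] by [a+1] in the second row,
    whose sum therefore decreases. *)
Lemma translates_reduced n k R : R \in SYT k -> size R = 2 -> exists C,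
  [/\ C \in SYT k, shape C = shape R, forall a, ~~ last_below a C,
      translates n k R C & translates n k C R].
Proof.
have [m] := ubnP (sumn (nth [::] R 1)); elim: m R => // m IH R lt_m RS R2.
have [/existsP[[a lt_a] /= lastR]|none] := boolP [exists a : 'I_k, last_below a R]; last first.
  exists R; have R0 : [::] \notin R by move: RS; rewrite SYT_tableau => /andP[/and3P[]].
  have trR : translates n k R R.
    have idR T : T \in SYT_inner n k R -> inner_translation R R T = T.
      by case/SYT_innerP=> tab _ _ inT; apply: inner_translation_id inT.
    by split=> [T TR|S T SR TR]; rewrite !idR.
  split=> // a; apply: contra none => lastR; apply/existsP.
  have ak := flippable_bound RS (_ : flippable a R).
  have lt_a : a < k by apply: leq_trans (ak _); rewrite ?leqnSn // /flippable lastR orbT.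
  by exists (Ordinal lt_a).
have fR : flippable a R by rewrite /flippable lastR orbT.
have RS' := flip_SYT RS fR; have R2' : size (flip_tableau a R) = 2 by rewrite size_map.
have [|C [CS shC noC RC CR]] := IH (flip_tableau a R) _ RS' R2'.
  rewrite nth_flip; rewrite ltnS in lt_m; apply: leq_trans lt_m.
  move: RS; rewrite SYT_tableau => /andP[tab pR]; have uR : uniq (flatten R) by rewrite (perm_uniq pR) iota_uniq.
  have [t0 [t1 [t' [RE _ [_ types]]]]] := flippable_rows tab uR fR.
  have [_ f1] := types lastR; case/and3P: (lastR) => _ _ m2.
  apply: (ltn_sumn_map _ m2); last by rewrite swap_succ_right.
  move=> y yR; rewrite /swap_succ; case: eqP => [yE|_]; last by case: eqP => // ->.
  have : a.+1 \in filter (in_triple a) t1.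
    by rewrite mem_filter /in_triple -yE; move: yR; rewrite RE /= => ->; lia.
  by rewrite f1 inE; lia.
exists C; split=> //; first by rewrite shC shape_flip.
  exact: translates_trans (translates_flip n RS R2 fR) RC.
apply: translates_trans CR _; rewrite -{2}(flip_tableauK a R).
by apply: translates_flip; rewrite // flippable_flip.
Qed.

Lemma ltn_count_nth r i v : pairwise ltn r -> i < size r -> nth 0 r i < v ->
  i < count (ltn^~ v) r.
Proof.
elim: r i => //= x r IH i /andP[xr pr]; case: i => [|i] /=; first by move=> _ ->.
rewrite ltnS => lt_i lt_v; have := IH i pr lt_i lt_v.
have : x < nth 0 r i by apply: (allP xr); apply: mem_nth.
by move=> lt_x; rewrite (ltn_trans lt_x lt_v).
Qed.

(** Above and to the left of the entry of index [i] there are [2i+1] smaller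
    entries. If there were more, then its two predecessors would lie in the first
    row, against the reducedness of the tableau. *)
Lemma reduced_second_row k r0 r1 i : [:: r0; r1] \in SYT k ->
  (forall a, ~~ last_below a [:: r0; r1]) -> i < size r1 -> nth 0 r1 i = (i.*2).+2.
Proof.
rewrite SYT_tableau /= cats0 => /andP[tab pR] red.
move: (tab); rewrite !is_tableau_cons => /and4P[_ p0 ab /and4P[_ p1 _ _]].
have [le_sz cols] := row_aboveP _ _ ab.
elim/ltn_ind: i => i IH lt_i; set v := nth 0 r1 i.
have incr1 j1 j2 : j1 < size r1 -> j2 < size r1 -> j1 < j2 -> nth 0 r1 j1 < nth 0 r1 j2.
  by move: p1 => /(pairwiseP 0); apply.
have vr : v \in r1 by apply: mem_nth.
have memR x : x \in iota 1 k = (x \in r0) || (x \in r1) by rewrite -(perm_mem pR) mem_cat.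
have vk : 0 < v <= k by have := memR v; rewrite vr orbT mem_iota add1n ltnS.
have ge_v : (i.*2).+2 <= v.
  have cE : count (ltn^~ v) r0 + count (ltn^~ v) r1 = v.-1.
    rewrite -count_cat (seq.permP pR).
    have -> : iota 1 k = iota 1 v.-1 ++ iota v (k - v.-1).
      by have -> : iota v (k - v.-1) = iota (1 + v.-1) (k - v.-1);
        [rewrite add1n prednK //; case/andP: vk|rewrite -iotaD; congr iota; lia].
    rewrite count_cat; have -> : count (ltn^~ v) (iota 1 v.-1) = size (iota 1 v.-1).
      by apply/eqP; rewrite -all_count; apply/allP => x; rewrite mem_iota /=; lia.
    have -> : count (ltn^~ v) (iota v (k - v.-1)) = 0.
      by apply/eqP; rewrite -leqn0 leqNgt -has_count; apply/hasP => -[x]; rewrite mem_iota /=; lia.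
    by rewrite size_iota addn0.
  have c0 : i < count (ltn^~ v) r0 by apply: ltn_count_nth; rewrite ?(leq_trans lt_i) ?cols.
  have c1 : i <= count (ltn^~ v) r1.
    case: (posnP i) => [->|i0] //; rewrite -[X in X <= _](prednK i0).
    have lt_pred : i.-1 < size r1 by apply: leq_ltn_trans (leq_pred i) lt_i.
    by apply: ltn_count_nth => //; apply: incr1 => //; rewrite prednK.
  by rewrite -addnn; lia.
apply/eqP; rewrite eqn_leq ge_v andbT leqNgt; apply/negP => gt_v.
have small x : i.*2 < x -> x < v -> x \in r0.
  move=> gt_x lt_x; have : x \in iota 1 k.
    by rewrite mem_iota add1n ltnS (leq_ltn_trans _ gt_x) //= (leq_trans (ltnW lt_x)) //; case/andP: vk.
  rewrite memR => /orP[//|xr]; have lt_j : index x r1 < size r1 by rewrite index_mem.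
  have jE : nth 0 r1 (index x r1) = x by apply: nth_index.
  have lt_ji : index x r1 < i.
    rewrite ltnNge leq_eqVlt; apply/negP => /predU1P[eji|lt_ij].
      by move: lt_x; rewrite -jE -eji ltnn.
    by have := incr1 _ _ lt_i lt_j lt_ij; rewrite jE ltnNge (ltnW lt_x).
  by move: gt_x; rewrite -jE (IH _ lt_ji lt_j) -doubleS ltn_double ltnS leqNgt lt_ji.
case/negP: (red v.-2); apply/and3P; split=> /=.
- by apply: small; lia.
- by apply: small; lia.
- by have -> : v.-2.+2 = v by lia.
Qed.

Lemma reduced_unique k R R' : R \in SYT k -> R' \in SYT k -> size R = 2 ->
  shape R' = shape R -> (forall a, ~~ last_below a R) -> (forall a, ~~ last_below a R') ->
  R' = R.
Proof.
case: R => [|r0 [|r1 [|? ?]]] //; case: R' => [|r0' [|r1' [|? ?]]] //.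
move=> RS RS' _ [sz0 sz1] red red'.
have r1E : r1' = r1.
  apply: (@eq_from_nth _ 0) => // i lt_i.
  by rewrite (reduced_second_row RS' red' lt_i) (reduced_second_row RS red) // -sz1.
rewrite {}r1E in RS' *; congr [:: _; _].
move: RS RS'; rewrite !SYT_tableau /= !cats0 => /andP[tab pR] /andP[tab' pR'].
have pE : perm_eq r0' r0 by rewrite -(perm_cat2r r1) (perm_trans pR') // perm_sym.
have incr t0 : is_tableau [:: t0; r1] -> sorted ltn t0.
  by rewrite is_tableau_cons (sorted_pairwise ltn_trans) => /and4P[].
exact: (irr_sorted_eq ltn_trans ltnn (incr _ tab') (incr _ tab) (perm_mem pE)).
Qed.

Lemma translates_same_shape n k R R' : R \in SYT k -> R' \in SYT k -> size R = 2 ->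
  shape R' = shape R -> translates n k R R'.
Proof.
move=> RS RS' R2 sh; have R2' : size R' = 2 by rewrite -(size_map size) -/(shape R') sh size_map.
have [C [CS shC redC RC _]] := translates_reduced n RS R2.
have [C' [CS' shC' redC' _ CR']] := translates_reduced n RS' R2'.
have C2 : size C = 2 by rewrite -(size_map size) -/(shape C) shC size_map.
have CE : C' = C by apply: (reduced_unique CS CS'); rewrite // shC' sh shC.
by rewrite CE in CR'; apply: translates_trans RC CR'.
Qed.

Theorem proposition4p3 (n k : nat) (hk : 1 <= k) (hkn : k < n)
  (R R' : tableau) (hR : R \in SYT k) (hR' : R' \in SYT k)
  (hR2 : size R = 2) (hshape : shape R' = shape R)
  (S T : tableau)
  (hS : S \in SYT_inner n k R) (hT : T \in SYT_inner n k R)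
  (hcov : weak_cover n (SYT_inner n k R) S T) :
  weak_cover n (SYT_inner n k R')
    (inner_translation R R' S) (inner_translation R R' T).
Proof.
have hR2' : size R' = 2 by rewrite -(size_map size) -/(shape R') hshape size_map.
have [mem_tr le_tr] := translates_same_shape n hR hR' hR2 hshape.
have [mem_tr' le_tr'] := translates_same_shape n hR' hR hR2' (esym hshape).
have nonempty r : r \in SYT k -> [::] \notin r by rewrite SYT_tableau => /andP[/and3P[]].
have trK Q : Q \in SYT_inner n k R ->
    inner_translation R' R (inner_translation R R' Q) = Q.
  move=> /SYT_innerP[tab _ _ inQ]; rewrite inner_translation_comp.
  exact: inner_translation_id tab hR2 (nonempty _ hR) inQ.
have trK' Q : Q \in SYT_inner n k R' ->
    inner_translation R R' (inner_translation R' R Q) = Q.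
  move=> /SYT_innerP[tab _ _ inQ]; rewrite inner_translation_comp.
  exact: inner_translation_id tab hR2' (nonempty _ hR') inQ.
case: hcov => _ _ leST neST minST; split; [exact: mem_tr|exact: mem_tr|exact: le_tr| |].
  by move=> eqST; apply: neST; rewrite -(trK S hS) -(trK T hT) eqST.
case=> Q [QR' neQS neQT leSQ leQT]; apply: minST.
exists (inner_translation R' R Q); split; first exact: mem_tr'.
- by move=> QE; apply: neQS; rewrite -QE trK'.
- by move=> QE; apply: neQT; rewrite -QE trK'.
- by rewrite -(trK S hS); apply: le_tr' => //; apply: mem_tr.
- by rewrite -(trK T hT); apply: le_tr' => //; apply: mem_tr.
Qed.
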